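(* Let $m\ge 1$ be an integer, let $u=(u_1,\ldots,u_m)\in\mathbb{C}^m$ with $u\neq(0,\ldots,0)$, let $p_1,p_2,\lambda_1,\ldots,\lambda_m$ be non-zero complex constants, let $\lambda=(\lambda_1,\ldots,\lambda_m)$, and let $l\geq 2$ be an even integer. Then the partial differential equation $$f^3(z)+\partial_u^l(f(z))=p_1e^{\langle\lambda,\overline{z}\rangle}+p_2e^{-\langle\lambda,\overline{z}\rangle}$$ has transcendental entire solutions $f$ in $\mathbb{C}^m$, and the solutions are $$f(z)=ce^{\langle\lambda,\overline{z}\rangle/3}+de^{-\langle\lambda,\overline{z}\rangle/3},$$ where $c$ and $d$ are non-zero constants such that $c^3=p_1$, $d^3=p_2$ and $3cd+\left(\sum_{k=1}^m u_k\lambda_k/3\right)^l=0$.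
   Context: Notation: for $\lambda\in\mathbb{C}^m$ and $z=(z_1,\ldots,z_m)\in\mathbb{C}^m$, $\langle\lambda,\overline{z}\rangle=\sum_{k=1}^m\lambda_k z_k$. For $u\in\mathbb{C}^m\setminus\{0\}$, $\partial_u(f)=\sum_{j=1}^m u_j\frac{\partial f}{\partial z_j}$, and inductively $\partial_u^k(f)=\partial_u(\partial_u^{k-1}(f))$. An entire function in $\mathbb{C}^m$ is a holomorphic function $\mathbb{C}^m\to\mathbb{C}$; it is transcendental if it is not a polynomial.
   Formalization: The claim that the equation always has transcendental entire solutions is false (m=1, u=λ=p1=p2=1, l=2); it is replaced by: such solutions exist if and only if there are non-zero c, d with c^3=p1, d^3=p2 and 3cd+(sum u_kλ_k/3)^l=0. *)

(* Defs.v *)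
From mathcomp Require Import all_boot all_order all_algebra.
From mathcomp Require Import all_classical all_reals all_analysis.
From mathcomp Require Import complex.
From mathcomp Require mpoly.

Set Implicit Arguments.
Unset Strict Implicit.
Unset Printing Implicit Defensive.

Import Order.TTheory GRing.Theory Num.Theory.
Import numFieldNormedType.Exports.

Local Open Scope ring_scope.
Local Open Scope complex_scope.

(* Euler's formula: e^(x + iy) = e^x cos y + i e^x sin y. *)
Definition cexp (R : realType) (z : R[i]) : R[i] :=
  (expR (complex.Re z) * cos (complex.Im z)) +i*
  (expR (complex.Re z) * sin (complex.Im z)).

(* <a, conj b>: the pairing is bilinear, without conjugation. *)
Definition pairing (R : realType) (m : nat) (a b : 'rV[R[i]]_m) : R[i] :=
  \sum_(k < m) a 0 k * b 0 k.

(* The codomain R[i]^o is R[i] as a normed space over itself, so that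
   [differentiable] and ['D_v] are the complex (Frechet, resp. directional)
   notions. *)
Definition entire (R : realType) (m : nat) (f : 'rV[R[i]]_m -> R[i]^o) : Prop :=
  forall z, differentiable f z.

Definition polynomial_fun (R : realType) (m : nat)
    (f : 'rV[R[i]]_m -> R[i]^o) : Prop :=
  exists p : mpoly.mpoly m R[i],
    forall z, f z = mpoly.meval (fun k : 'I_m => z 0 k) p.

Definition transcendental_entire (R : realType) (m : nat)
    (f : 'rV[R[i]]_m -> R[i]^o) : Prop :=
  entire f /\ ~ polynomial_fun f.

Definition partial (R : realType) (m : nat) (j : 'I_m)
    (f : 'rV[R[i]]_m -> R[i]^o) : 'rV[R[i]]_m -> R[i]^o :=
  'D_(delta_mx 0 j) f.

Definition dpartial (R : realType) (m : nat) (u : 'rV[R[i]]_m)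
    (f : 'rV[R[i]]_m -> R[i]^o) : 'rV[R[i]]_m -> R[i]^o :=
  fun z => \sum_(j < m) u 0 j * partial j f z.

Definition pde_solution (R : realType) (m : nat) (u lam : 'rV[R[i]]_m)
    (p1 p2 : R[i]) (l : nat) (f : 'rV[R[i]]_m -> R[i]^o) : Prop :=
  forall z, f z ^+ 3 + iter l (dpartial u) f z =
    p1 * cexp (pairing lam z) + p2 * cexp (- pairing lam z).

Definition admissible (R : realType) (m : nat) (u lam : 'rV[R[i]]_m)
    (p1 p2 : R[i]) (l : nat) (c d : R[i]) : Prop :=
  [/\ c != 0, d != 0, c ^+ 3 = p1, d ^+ 3 = p2 &
      3 * c * d + (\sum_(k < m) u 0 k * lam 0 k / 3) ^+ l = 0].

(* Main.v *)
(** Write [W z = sum_k lam_k z_k] and [X = e^(|Re W|/3)]. If [N] is the supremum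
    of [(1 - |t|)^(l/2) |f (z + t u)|] over [|t| <= 1], the Cauchy estimate for
    [D^l f] at an almost maximal point, on a disc of radius [(1 - |t|)/2], turns
    [f^3 = p1 e^W + p2 e^(-W) - D^l f] into [N^3 <= C X^3 + C N], because
    [3 l/2 = l + l/2]. Hence [|f| <= K X], and then [|D^l f| <= K X] again by the
    Cauchy estimate. So where [Re W] is large [(f e^(-W/3))^3] tends to [p1] with
    error [O(X^-2)], and by connectedness of the half-space [f e^(-W/3)] tends to
    a single cube root [c] of [p1]; symmetrically one gets [d] where [Re W] is very
    negative. The entire function [f - c e^(W/3) - d e^(-W/3)] is then bounded and
    tends to [0] along a ray, so it vanishes by Liouville's theorem.

    Complex differentiability carries no continuity of the derivative, so the
    Cauchy formula starts from Goursat's theorem: for entire [q] with period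
    [2 pi i], the integral of [q] over a vertical period does not depend on the
    abscissa, and the choice [q w = f (z + e^w v) e^(-w)] yields ['d f z v] as
    [Re w] tends to [-oo]. *)
Require Import Defs.
From HB Require Import structures.
From mathcomp Require Import all_boot all_order all_algebra.
From mathcomp Require Import all_classical all_reals all_analysis.
From mathcomp Require Import complex.
From mathcomp Require Import ring lra.
Import Order.TTheory GRing.Theory Num.Theory.
Import numFieldNormedType.Exports.
Local Open Scope ring_scope.
Local Open Scope complex_scope.

Set Implicit Arguments.
Unset Strict Implicit.
Import ComplexField.Normc.

Local Notation Re := complex.Re.
Local Notation Im := complex.Im.

(** * The modulus on R[i] *)

(** The analysis sees the space only through the direction u and the form W, so it is carried out
    over an arbitrary normed space V, with a vector v1 such that W v1 = 1 in place of coordinates.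
    The parity of l is used twice: l/2 has to be an integer exponent of the weight, and (-1/3)^l =
    (1/3)^l makes D^l multiply both exponentials by the same factor. The iterated partial
    derivatives of the statement ask for Fréchet differentiability of every iterate on V, not only
    along lines. This is why Taylor remainders that are quadratic, and uniform near a point, are
    extracted from the Cauchy formula before any growth estimate. Real and imaginary parts are
    bounded separately throughout; this costs powers of 2, and only the finiteness of the constants
    matters. *)

Lemma normc_ge0 (R : rcfType) (z : R[i]) : 0 <= normc z.
Proof. by case: z => a b; exact: sqrtr_ge0. Qed.

Lemma normcE (R : rcfType) (z : R[i]) : `|z| = (normc z)%:C.
Proof. by rewrite normc_def; case: z. Qed.

Lemma normcB_sym (R : rcfType) (x y : R[i]) : normc (x - y) = normc (y - x).
Proof. by rewrite -normcN opprB. Qed.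

Lemma normcB_le (R : rcfType) (x y : R[i]) : normc (x - y) <= normc x + normc y.
Proof. by rewrite -(normcN y) le_normcD. Qed.

Lemma lerB_normc (R : rcfType) (x y : R[i]) : normc x - normc y <= normc (x - y).
Proof. by have := le_normcD (x - y) y; rewrite subrK lerBlDr. Qed.

Lemma normc_real (R : rcfType) (a : R) : normc (a%:C) = `|a|.
Proof. by rewrite /= expr0n /= addr0 sqrtr_sqr. Qed.

Lemma normcX (R : rcfType) (z : R[i]) n : normc (z ^+ n) = normc z ^+ n.
Proof. by elim: n => [|n IH]; rewrite ?expr0 ?normc1// !exprS normcM IH. Qed.

Lemma normc_eq0 (R : rcfType) (z : R[i]) : (normc z == 0) = (z == 0).
Proof. by apply/eqP/eqP => [/eq0_normc//|->]; rewrite normc0. Qed.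

Lemma normc_gt0 (R : rcfType) (z : R[i]) : (0 < normc z) = (z != 0).
Proof. by rewrite lt_neqAle eq_sym normc_eq0 normc_ge0 andbT. Qed.

Lemma ReB (R : rcfType) (x y : R[i]) : Re (x - y) = Re x - Re y.
Proof. by case: x y => a b [c d]. Qed.

Lemma ImB (R : rcfType) (x y : R[i]) : Im (x - y) = Im x - Im y.
Proof. by case: x y => a b [c d]. Qed.

Lemma ReN (R : rcfType) (x : R[i]) : Re (- x) = - Re x.
Proof. by case: x. Qed.

Lemma ImN (R : rcfType) (x : R[i]) : Im (- x) = - Im x.
Proof. by case: x. Qed.

Lemma ReD (R : rcfType) (x y : R[i]) : Re (x + y) = Re x + Re y.
Proof. by case: x y => a b [c d]. Qed.

Lemma ImD (R : rcfType) (x y : R[i]) : Im (x + y) = Im x + Im y.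
Proof. by case: x y => a b [c d]. Qed.

Lemma ReM (R : rcfType) (x y : R[i]) : Re (x * y) = Re x * Re y - Im x * Im y.
Proof. by case: x y => a b [c d]. Qed.

Lemma ImM (R : rcfType) (x y : R[i]) : Im (x * y) = Re x * Im y + Im x * Re y.
Proof. by case: x y => a b [c d]. Qed.

Lemma Re_le_normc (R : rcfType) (z : R[i]) : `|Re z| <= normc z.
Proof. by case: z => a b /=; rewrite -sqrtr_sqr ler_wsqrtr ?lerDl ?addr_ge0 ?sqr_ge0. Qed.

Lemma Im_le_normc (R : rcfType) (z : R[i]) : `|Im z| <= normc z.
Proof. by case: z => a b /=; rewrite -sqrtr_sqr ler_wsqrtr ?lerDr ?addr_ge0 ?sqr_ge0. Qed.

Lemma normc_le_ReIm (R : rcfType) (z : R[i]) : normc z <= `|Re z| + `|Im z|.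
Proof.
case: z => a b /=; rewrite -[leRHS]ger0_norm ?addr_ge0//.
rewrite -(sqrtr_sqr (_ + _)) ler_wsqrtr//.
rewrite sqrrD !real_normK ?num_real// -addrA lerD2l.
by rewrite lerDr mulrn_wge0 ?mulr_ge0.
Qed.

Lemma ReImP (R : rcfType) (x y : R[i]) : Re x = Re y -> Im x = Im y -> x = y.
Proof. by case: x y => a b [c d] /= -> ->. Qed.

(** * Integrals over real segments *)

(** For b < a the segment is empty and the value is 0, not the oriented integral; hence the
    hypotheses [a <= b] below. *)
Definition rint (R : realType) (F : R -> R) (a b : R) : R :=
  Rintegral (@lebesgue_measure R) `[a, b]%classic F.

Section rint.
Variable R : realType.
Implicit Types (F G : R -> R) (a b c : R).

Lemma integrable_itv F a b : continuous F ->
  (@lebesgue_measure R).-integrable `[a, b]%classic (EFin \o F).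
Proof.
move=> cF; apply: continuous_compact_integrable; first exact: segment_compact.
exact: continuous_subspaceT.
Qed.

Lemma rintD F G a b : continuous F -> continuous G ->
  rint (fun x => F x + G x) a b = rint F a b + rint G a b.
Proof. by move=> cF cG; rewrite /rint RintegralD//; exact: integrable_itv. Qed.

Lemma rintB F G a b : continuous F -> continuous G ->
  rint (fun x => F x - G x) a b = rint F a b - rint G a b.
Proof. by move=> cF cG; rewrite /rint RintegralB//; exact: integrable_itv. Qed.

Lemma rintZ F k a b : continuous F ->
  rint (fun x => k * F x) a b = k * rint F a b.
Proof. by move=> cF; rewrite /rint RintegralZl//; exact: integrable_itv. Qed.

Lemma rint_split F a b c : continuous F -> a <= b -> b <= c ->
  rint F a c = rint F a b + rint F b c.
Proof.
move=> cF ab bc; rewrite /rint.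
have := @Rintegral_itvB R F (BLeft a) (BRight c) b.
rewrite !bnd_simp => /(_ (integrable_itv a c cF) ab bc).
rewrite Rintegral_itv_obnd_cbnd//; first by move/eqP; rewrite subr_eq addrC => /eqP.
apply: integrableS (integrable_itv b c cF) => //.
exact: subset_itv_oc_cc.
Qed.

Lemma rint_le F a b M : continuous F -> a <= b ->
  (forall x, a <= x <= b -> `|F x| <= M) -> `|rint F a b| <= M * (b - a).
Proof.
move=> cF ab FM; rewrite /rint.
apply: (le_trans (le_normr_Rintegral _ (integrable_itv a b cF))) => //.
have -> : M * (b - a) = \int[@lebesgue_measure R]_(x in `[a, b]) (cst M x).
  rewrite Rintegral_cst//.
  by rewrite /= lebesgue_measure_itv/= lte_fin; case: ltP ab => // ba ab;
     rewrite (@le_anti _ _ a b) ?ab ?ba// subrr.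
apply: le_Rintegral => //.
- apply: (@integrable_itv (fun x => `|F x|)) => x.
  exact: (continuous_comp (cF x) (@norm_continuous _ _ _)).
- by apply: (@integrable_itv (cst M)) => x; exact: cvg_cst.
Qed.

Lemma rint_FTC F G a b : a <= b -> continuous F ->
  (forall x : R, is_derive x 1 G (F x)) -> rint F a b = G b - G a.
Proof.
rewrite le_eqVlt => /predU1P[<- _ _|ab cF dG].
  by rewrite /rint set_itv1 Rintegral_set1 subrr.
have cG : continuous G.
  by move=> x; apply: differentiable_continuous; apply/derivable1_diffP.
rewrite /rint /Rintegral (@continuous_FTC2 R F G)//.
- exact: continuous_subspaceT.
- split => //; [exact: cvg_at_right_filter (cG _)| exact: cvg_at_left_filter (cG _)].
- by move=> x _; rewrite derive1E derive_val.
Qed.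

End rint.

(** * Real-valued norms and differentiability by explicit estimates *)

Definition vnorm (R : realType) (V : normedModType R[i]) (v : V) : R := Re `|v|.

Section vnorm.
Variables (R : realType) (V : normedModType R[i]).
Implicit Types v w : V.

(** The norm of V takes values in R[i]. Being nonnegative it is real, so its real part loses nothing
    and lives in a totally ordered field. *)
Lemma normvE v : `|v| = (vnorm v)%:C.
Proof. by rewrite /vnorm RRe_real// ger0_real. Qed.

Lemma vnorm_ge0 v : 0 <= vnorm v.
Proof. by rewrite -lecR -normvE normr_ge0. Qed.

Lemma vnormD v w : vnorm (v + w) <= vnorm v + vnorm w.
Proof. by rewrite -lecR rmorphD/= -!normvE ler_normD. Qed.

Lemma vnormZ (a : R[i]) v : vnorm (a *: v) = normc a * vnorm v.
Proof. by apply/complexI; rewrite rmorphM/= -!normvE normrZ normcE. Qed.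

Lemma vnorm0 : vnorm (0 : V) = 0.
Proof. by rewrite /vnorm normr0. Qed.

Lemma vnorm_gt0 v : (0 < vnorm v) = (v != 0).
Proof. by rewrite -ltcR -normvE normr_gt0. Qed.

Lemma near0_vnorm (P : V -> Prop) :
  (\forall h \near (0 : V), P h) <->
  exists2 d : R, 0 < d & forall h, vnorm h < d -> P h.
Proof.
rewrite nbhs_norm0P; split => [[e /= e0 He]|[d d0 Hd]].
  have eE : e = (Re e)%:C by rewrite RRe_real// ger0_real// ltW.
  exists (Re e); first by rewrite -ltcR -eE.
  by move=> h hd; apply: He => /=; rewrite normvE eE ltcR.
exists d%:C; first by rewrite /= ltcR.
by move=> h /=; rewrite normvE ltcR; exact: Hd.
Qed.

Lemma differentiable_approx (f : V -> R[i]^o) z : differentiable f z ->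
  forall e : R, 0 < e -> exists2 d : R, 0 < d &
    forall h, vnorm h < d -> normc (f (z + h) - f z - 'd f z h) <= e * vnorm h.
Proof.
move=> /diff_locally /eqaddoP + e e0 => /(_ e%:C).
rewrite ltcR => /(_ e0) /near0_vnorm[d d0 Hd].
exists d => // h /Hd.
rewrite [X in `|X|](_ : _ = f (z + h) - f z - 'd f z h); last first.
  by rewrite -addrA -opprD [z + h]addrC.
by rewrite normvE normcE -rmorphM lecR.
Qed.

(** V may have infinite dimension, so the continuity of the candidate differential has to be
    supplied; the bound C does this. *)
Lemma differentiable_of_approx (f : V -> R[i]^o) z (L : {linear V -> R[i]^o})
    (C : R) : (forall h, normc (L h) <= C * vnorm h) ->
  (forall e : R, 0 < e -> exists2 d : R, 0 < d &
    forall h, vnorm h < d -> normc (f (z + h) - f z - L h) <= e * vnorm h) ->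
  differentiable f z /\ 'd f z = L :> (V -> R[i]^o).
Proof.
move=> LC Lf.
have cL : continuous L.
  apply/linear_bounded_continuous/linear_boundedP.
  near=> r => x.
  have : (C%:C <= r) by near: r; apply: nbhs_pinfty_ge; rewrite realE ler0c lecR le_total.
  move=> Cr; apply: (@le_trans _ _ (C%:C * `|x|)); last exact: ler_wpM2r.
  by rewrite normvE normcE -rmorphM lecR.
have Lo : f \o shift z = cst (f z) + L +o_ 0 id.
  apply/eqaddoP => e e0.
  have eE : e = (Re e)%:C by rewrite RRe_real// ger0_real// ltW.
  have /Lf[d d0 Hd] : 0 < Re e by rewrite -ltcR -eE.
  apply/near0_vnorm; exists d => // h /Hd hd.
  rewrite [X in `|X|](_ : _ = f (z + h) - f z - L h); last first.
    by rewrite -addrA -opprD [z + h]addrC.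
  by rewrite eE normvE normcE -rmorphM lecR.
have dL : 'd f z = L :> (V -> R[i]^o) by exact: diff_unique.
split; last exact: dL.
by apply/diff_locallyP; rewrite dL; split; [exact: cL|exact: Lo].
Unshelve. all: by end_near. Qed.

Lemma continuous_approx (f : V -> R[i]^o) z : differentiable f z ->
  forall e : R, 0 < e -> exists2 d : R, 0 < d &
    forall h, vnorm h < d -> normc (f (z + h) - f z) < e.
Proof.
move=> /differentiable_continuous /(@cvgrPdist_lt _ _ _ _ _) + e e0.
move=> /(_ e%:C); rewrite ltcR => /(_ e0).
move=> /nbhs_normP[d /= d0 Hd].
have dE : d = (Re d)%:C by rewrite RRe_real// ger0_real// ltW.
exists (Re d); first by rewrite -ltcR -dE.
move=> h hd; have := Hd (z + h).
rewrite /= opprD addNKr normrN normvE dE ltcR => /(_ hd).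
by rewrite normcE ltcR normcB_sym.
Qed.

End vnorm.

Lemma vnorm_complex (R : realType) (z : R[i]) : vnorm (z : R[i]^o) = normc z.
Proof. by rewrite /vnorm normcE. Qed.

Lemma derive_approx (R : realType) (f : R -> R) (x df : R) : is_derive x 1 f df ->
  forall e : R, 0 < e -> exists2 d : R, 0 < d &
    forall h, `|h| < d -> `|f (x + h) - f x - df * h| <= e * `|h|.
Proof.
move=> [/derivable_nbhs + dfE] e e0; rewrite dfE => /eqaddoP /(_ e e0).
move=> /nbhs_norm0P[d /= d0 Hd]; exists d => // h /Hd.
rewrite [X in `|X|](_ : _ = f (x + h) - f x - df * h)//.
by rewrite -addrA -opprD [x + h]addrC -[h in f (h + _)]mulr1 [df * h]mulrC.
Qed.

(** * Integrals of complex-valued functions of a real variable *)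

Definition cint (R : realType) (F : R -> R[i]^o) (a b : R) : R[i] :=
  (rint (fun x => Re (F x)) a b) +i* (rint (fun x => Im (F x)) a b).

Section cint.
Variable R : realType.
Implicit Types (F G : R -> R[i]^o) (a b c : R).

Lemma contraction_continuous (V : normedModType R[i]) (g : V -> R) :
  (forall v w, `|g v - g w| <= vnorm (v - w)) -> continuous g.
Proof.
move=> gl z; apply/(@cvgrPdist_lt _ _ _ (nbhs z)) => e e0.
apply/nbhs_normP; exists e%:C; first by rewrite /= ltcR.
by move=> w /=; rewrite normvE ltcR; apply: le_lt_trans.
Qed.

Lemma continuous_Re : continuous (fun z : R[i]^o => Re z).
Proof.
apply: (@contraction_continuous R[i]^o) => z w.
by rewrite vnorm_complex -ReB Re_le_normc.
Qed.

Lemma continuous_Im : continuous (fun z : R[i]^o => Im z).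
Proof.
apply: (@contraction_continuous R[i]^o) => z w.
by rewrite vnorm_complex -ImB Im_le_normc.
Qed.

Lemma continuous_complexP (F : R -> R[i]^o) :
  (forall x (e : R), 0 < e -> exists2 d : R, 0 < d &
     forall h, `|h| < d -> normc (F (x + h) - F x) < e) -> continuous F.
Proof.
move=> H x; apply/cvgrPdist_lt => e e0.
have eE : e = (Re e)%:C by rewrite RRe_real// ger0_real// ltW.
have /(H x)[d d0 Hd] : 0 < Re e by rewrite -ltcR -eE.
apply/nbhs_normP; exists d => //= y xy.
have := Hd (y - x); rewrite [x + _]addrC subrK distrC => /(_ xy) H1.
by rewrite eE normcE ltcR normcB_sym.
Qed.

Lemma continuous_horizontal (y : R) : continuous (fun x : R => x +i* y : R[i]^o).
Proof.
apply: continuous_complexP => x e e0; exists e => // h he.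
by apply: le_lt_trans (normc_le_ReIm _) _; rewrite /= subrr normr0 addr0 addrC addKr.
Qed.

Lemma continuous_vertical (x : R) : continuous (fun y : R => x +i* y : R[i]^o).
Proof.
apply: continuous_complexP => y e e0; exists e => // h he.
by apply: le_lt_trans (normc_le_ReIm _) _; rewrite /= subrr normr0 add0r addrC addKr.
Qed.

Lemma continuous_ReF F : continuous F -> continuous (fun x => Re (F x)).
Proof. by move=> cF x; exact: (continuous_comp (cF x) (@continuous_Re _)). Qed.

Lemma continuous_ImF F : continuous F -> continuous (fun x => Im (F x)).
Proof. by move=> cF x; exact: (continuous_comp (cF x) (@continuous_Im _)). Qed.

Lemma continuous_sub F G :
  continuous F -> continuous G -> continuous (fun x => F x - G x).
Proof. by move=> cF cG x; apply: continuousB; [exact: cF|exact: cG]. Qed.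

Lemma continuous_cmul (c : R[i]) F :
  continuous F -> continuous (fun x => c * F x : R[i]^o).
Proof. by move=> cF x; apply: continuousM; [exact: cvg_cst|exact: cF]. Qed.

Lemma cintD F G a b : continuous F -> continuous G ->
  cint (fun x => F x + G x) a b = cint F a b + cint G a b.
Proof.
move=> cF cG; apply: ReImP => /=.
  rewrite -rintD; [|exact: continuous_ReF..].
  by congr rint; apply/funext => x; rewrite ReD.
rewrite -rintD; [|exact: continuous_ImF..].
by congr rint; apply/funext => x; rewrite ImD.
Qed.

Lemma cintZ F (k : R[i]) a b : continuous F ->
  cint (fun x => k * F x) a b = k * cint F a b.
Proof.
move=> cF.
have cR := continuous_ReF cF; have cI := continuous_ImF cF.
have cZ (r : R) (g : R -> R) : continuous g -> continuous (fun x => r * g x).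
  by move=> cg x; apply: continuousM (cg x); exact: cvg_cst.
apply: ReImP; rewrite ?ReM ?ImM /=.
  rewrite -!rintZ// -rintB; [|exact: cZ..].
  by congr rint; apply/funext => x; rewrite ReM.
rewrite -!rintZ// -rintD; [|exact: cZ..].
by congr rint; apply/funext => x; rewrite ImM.
Qed.

Lemma cintB F G a b : continuous F -> continuous G ->
  cint (fun x => F x - G x) a b = cint F a b - cint G a b.
Proof.
move=> cF cG.
have -> : (fun x => F x - G x) = (fun x => F x + (-1) * G x).
  by apply/funext => x; rewrite mulN1r.
have cN : continuous (fun x => (-1) * G x : R[i]^o) by exact: continuous_cmul.
by rewrite (cintD a b cF cN) (cintZ (-1) a b cG) mulN1r.
Qed.

Lemma cint_split F a b c : continuous F -> a <= b -> b <= c ->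
  cint F a c = cint F a b + cint F b c.
Proof.
move=> cF ab bc; apply: ReImP => /=.
  by rewrite -rint_split//; exact: continuous_ReF.
by rewrite -rint_split//; exact: continuous_ImF.
Qed.

(** The factor 2 comes from adding the bounds for the real and the imaginary part. *)
Lemma cint_le F a b M : continuous F -> a <= b ->
  (forall x, a <= x <= b -> normc (F x) <= M) ->
  normc (cint F a b) <= 2 * M * (b - a).
Proof.
move=> cF ab FM; apply: le_trans (normc_le_ReIm _) _ => /=.
rewrite -mulrA mulr2n mulrDl mul1r; apply: lerD.
  apply: rint_le => //; first exact: continuous_ReF.
  by move=> x /FM; apply: le_trans; exact: Re_le_normc.
apply: rint_le => //; first exact: continuous_ImF.
by move=> x /FM; apply: le_trans; exact: Im_le_normc.
Qed.

Lemma cint_FTC F (G H : R -> R) a b : a <= b -> continuous F ->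
  (forall x : R, is_derive x 1 G (Re (F x))) ->
  (forall x : R, is_derive x 1 H (Im (F x))) ->
  cint F a b = (G b - G a) +i* (H b - H a).
Proof.
move=> ab cF dG dH; rewrite /cint.
by rewrite (rint_FTC ab (continuous_ReF cF) dG) (rint_FTC ab (continuous_ImF cF) dH).
Qed.

Lemma is_derive_quadratic (p q x : R) :
  is_derive x 1 (fun t : R => p * t + q * t ^+ 2 / 2) (p + q * x).
Proof.
have -> : (fun t : R => p * t + q * t ^+ 2 / 2) =
    (p \*: (@id R)) + ((q / 2) \*: ((@id R) ^+ 2)).
  by apply/funext => t; rewrite -[RHS]/(p * t + q / 2 * (t ^+ 2)); ring.
by apply: is_derive_eq; rewrite /GRing.scale /=; field.
Qed.

Lemma cint_affine (p q : R[i]) a b : a <= b ->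
  cint (fun t : R => p + q * t%:C) a b =
  p * (b - a)%:C + q * ((b ^+ 2 - a ^+ 2) / 2)%:C.
Proof.
move=> ab.
have cF : continuous (fun t : R => p + q * t%:C : R[i]^o).
  move=> x; apply: continuousD; first exact: cvg_cst.
  apply: continuousM; first exact: cvg_cst.
  exact: continuous_horizontal.
have dG (x : R) : is_derive x 1 (fun t => Re p * t + Re q * t ^+ 2 / 2)
    (Re (p + q * x%:C)).
  apply: is_derive_eq (is_derive_quadratic (Re p) (Re q) x) _.
  by rewrite ReD ReM /=; ring.
have dH (x : R) : is_derive x 1 (fun t => Im p * t + Im q * t ^+ 2 / 2)
    (Im (p + q * x%:C)).
  apply: is_derive_eq (is_derive_quadratic (Im p) (Im q) x) _.
  by rewrite ImD ImM /=; ring.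
rewrite (cint_FTC ab cF dG dH).
by apply: ReImP; rewrite ?ReD ?ImD ?ReM ?ImM /=; ring.
Qed.

Lemma cint_cst (c : R[i]) a b : a <= b ->
  cint (fun=> c) a b = c * (b - a)%:C.
Proof.
move=> ab; have := cint_affine c 0 ab; rewrite mul0r addr0 => <-.
by congr cint; apply/funext => t; rewrite mul0r addr0.
Qed.

End cint.

(** * Goursat's theorem *)

(** A step moves the left endpoint by at most the new length, which is half the old one, so the
    right endpoints decrease; the supremum of the left endpoints therefore lies in every
    interval. *)
Lemma dyadic_nested (R : realType) (u : nat -> R) (w : R) : 0 <= w ->
  (forall n, u n <= u n.+1 <= u n + w / 2 ^+ n.+1) ->
  exists X, forall n, u n <= X <= u n + w / 2 ^+ n.
Proof.
move=> w0 ustep.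
have u_nd n k : u n <= u (n + k)%N.
  elim: k => [|k IH]; first by rewrite addn0.
  by rewrite addnS; apply: le_trans IH _; case/andP: (ustep (n + k)%N).
have v_ni n k : u (n + k)%N + w / 2 ^+ (n + k) <= u n + w / 2 ^+ n.
  elim: k => [|k IH]; first by rewrite addn0.
  apply: le_trans IH; rewrite addnS; case/andP: (ustep (n + k)%N) => _.
  have -> : w / 2 ^+ (n + k) = w / 2 ^+ (n + k).+1 + w / 2 ^+ (n + k).+1.
    by rewrite exprS; field; rewrite expf_neq0// pnatr_eq0.
  by rewrite addrA lerD2r.
have wp n : 0 <= w / 2 ^+ n by rewrite divr_ge0// exprn_ge0.
have uv m n : u m <= u n + w / 2 ^+ n.
  apply: le_trans (u_nd m n) _; apply: le_trans (v_ni n m).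
  by rewrite [(n + m)%N]addnC lerDl.
have us : has_sup (range u).
  split; first by exists (u 0%N), 0%N.
  by exists (u 0%N + w / 2 ^+ 0) => _ [m _ <-].
exists (sup (range u)) => n; apply/andP; split.
  by apply: sup_upper_bound => //; exists n.
by apply: sup_le_ub; [case: us | move=> _ [m _ <-]].
Qed.

Lemma dyadic_small (R : realType) (w d : R) : 0 <= w -> 0 < d ->
  exists n, w / 2 ^+ n < d.
Proof.
move=> w0 d0; exists (Num.bound (w / d)).
rewrite ltr_pdivrMr ?exprn_gt0// mulrC -ltr_pdivrMr//.
apply: lt_le_trans (archi_boundP _) _; first by rewrite divr_ge0// ltW.
by rewrite -natrX ler_nat ltnW// ltn_expl.
Qed.

(** Compactness of a rectangle in the form of quartering: a bad rectangle has a bad quarter, and the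
    nested bad quarters shrink to a point where the local hypothesis is violated. It serves both
    Goursat's theorem and boundedness on discs. *)
Lemma box_induction (R : realType) (P : R -> R -> R -> R -> Prop) (a b c d : R) :
  a <= b -> c <= d ->
  (forall x y w h, 0 <= w -> 0 <= h ->
    P x (x + w) y (y + h) -> P x (x + w) (y + h) (y + h + h) ->
    P (x + w) (x + w + w) y (y + h) -> P (x + w) (x + w + w) (y + h) (y + h + h) ->
    P x (x + w + w) y (y + h + h)) ->
  (forall x y, exists2 e : R, 0 < e & forall x1 x2 y1 y2,
    x1 <= x <= x2 -> y1 <= y <= y2 -> x2 - x1 < e -> y2 - y1 < e ->
    P x1 x2 y1 y2) ->
  P a b c d.
Proof.
move=> ab cd Psub Ploc; apply: contrapT => nP.
set w := b - a; set h := d - c.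
have w0 : 0 <= w by rewrite subr_ge0.
have h0 : 0 <= h by rewrite subr_ge0.
pose box n (p : R * R) :=
  P p.1 (p.1 + w / 2 ^+ n) p.2 (p.2 + h / 2 ^+ n).
(* The hypothesis [~ box n p] stands under the existential so that [choice] yields a total function
   [nxt]. *)
have stp n (p : R * R) : exists q : R * R, ~ box n p ->
  [/\ ~ box n.+1 q, p.1 <= q.1 <= p.1 + w / 2 ^+ n.+1
    & p.2 <= q.2 <= p.2 + h / 2 ^+ n.+1].
  have [?|nb] := pselect (box n p); first by exists p.
  have wn : 0 <= w / 2 ^+ n.+1 by rewrite divr_ge0// exprn_ge0.
  have hn : 0 <= h / 2 ^+ n.+1 by rewrite divr_ge0// exprn_ge0.
  have wE : w / 2 ^+ n = w / 2 ^+ n.+1 + w / 2 ^+ n.+1.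
    by rewrite exprS; field; rewrite expf_neq0// pnatr_eq0.
  have hE : h / 2 ^+ n = h / 2 ^+ n.+1 + h / 2 ^+ n.+1.
    by rewrite exprS; field; rewrite expf_neq0// pnatr_eq0.
  set w' := w / 2 ^+ n.+1 in wn wE *; set h' := h / 2 ^+ n.+1 in hn hE *.
  have H := @Psub p.1 p.2 w' h' wn hn.
  have [b1|] := pselect (box n.+1 (p.1, p.2)); last first.
    by move=> nb1; exists (p.1, p.2) => _; split => //=; rewrite ?lexx ?lerDl ?wn ?hn.
  have [b2|] := pselect (box n.+1 (p.1, p.2 + h')); last first.
    by move=> nb1; exists (p.1, p.2 + h') => _; split => //=; rewrite ?lexx ?lerDl ?wn ?hn.
  have [b3|] := pselect (box n.+1 (p.1 + w', p.2)); last first.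
    by move=> nb1; exists (p.1 + w', p.2) => _; split => //=; rewrite ?lexx ?lerDl ?wn ?hn.
  have [b4|] := pselect (box n.+1 (p.1 + w', p.2 + h')); last first.
    by move=> nb1; exists (p.1 + w', p.2 + h') => _; split => //=; rewrite ?lexx ?lerDl ?wn ?hn.
  by exfalso; apply: nb; rewrite /box wE hE !addrA; exact: H.
have [nxt nxtP] : exists nxt : nat * (R * R) -> R * R, forall np, ~ box np.1 np.2 ->
  [/\ ~ box np.1.+1 (nxt np), np.2.1 <= (nxt np).1 <= np.2.1 + w / 2 ^+ np.1.+1
    & np.2.2 <= (nxt np).2 <= np.2.2 + h / 2 ^+ np.1.+1].
  by have [g gP] := choice (fun np : nat * (R * R) => stp np.1 np.2); exists g.
pose s := fix s n := if n is k.+1 then nxt (k, s k) else (a, c).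
have ns n : ~ box n (s n).
  elim: n => [|n IH]; first by rewrite /box /= !expr0 !divr1 /w /h !subrKC.
  by case: (nxtP (n, s n) IH).
have [|X HX] := @dyadic_nested R (fun n => (s n).1) w w0.
  by move=> n; case: (nxtP (n, s n) (ns n)).
have [|Y HY] := @dyadic_nested R (fun n => (s n).2) h h0.
  by move=> n; case: (nxtP (n, s n) (ns n)).
have [e e0 He] := Ploc X Y.
have [n Hn] := dyadic_small (addr_ge0 w0 h0) e0.
apply: (ns n); apply: He => //.
  rewrite addrAC subrr add0r; apply: le_lt_trans Hn.
  by rewrite ler_pM2r ?invr_gt0 ?exprn_gt0// lerDl.
rewrite addrAC subrr add0r; apply: le_lt_trans Hn.
by rewrite ler_pM2r ?invr_gt0 ?exprn_gt0// lerDr.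
Qed.

(** The counterclockwise contour integral around the rectangle: bottom minus top, plus 'i times
    right minus left, since dz = i dy on vertical sides. *)
Definition boundary_int (R : realType) (q : R[i]^o -> R[i]^o) (x1 x2 y1 y2 : R) : R[i] :=
  cint (fun x => q (x +i* y1)) x1 x2 - cint (fun x => q (x +i* y2)) x1 x2
  + 'i%C * (cint (fun y => q (x2 +i* y)) y1 y2 - cint (fun y => q (x1 +i* y)) y1 y2).

Section Goursat.
Variable R : realType.
Implicit Types (q r : R[i]^o -> R[i]^o) (x y : R).

Lemma continuous_hslice q y : continuous q -> continuous (fun x => q (x +i* y)).
Proof. by move=> cq x; exact: (continuous_comp (@continuous_horizontal _ _ _) (cq _)). Qed.

Lemma continuous_vslice q x : continuous q -> continuous (fun y => q (x +i* y)).
Proof. by move=> cq y; exact: (continuous_comp (@continuous_vertical _ _ _) (cq _)). Qed.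

Lemma boundary_intB q r x1 x2 y1 y2 : continuous q -> continuous r ->
  boundary_int (fun z => q z - r z) x1 x2 y1 y2 =
  boundary_int q x1 x2 y1 y2 - boundary_int r x1 x2 y1 y2.
Proof.
move=> cq cr; rewrite /boundary_int !cintB;
  [|exact: continuous_vslice|exact: continuous_vslice|exact: continuous_vslice
   |exact: continuous_vslice|exact: continuous_hslice|exact: continuous_hslice
   |exact: continuous_hslice|exact: continuous_hslice].
by ring.
Qed.

Lemma boundary_int_split q x1 xm x2 y1 ym y2 : continuous q ->
  x1 <= xm -> xm <= x2 -> y1 <= ym -> ym <= y2 ->
  boundary_int q x1 x2 y1 y2 =
  boundary_int q x1 xm y1 ym + boundary_int q x1 xm ym y2 +
  (boundary_int q xm x2 y1 ym + boundary_int q xm x2 ym y2).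
Proof.
move=> cq h1 h2 h3 h4; rewrite /boundary_int.
rewrite (cint_split (continuous_hslice (y:=y1) cq) h1 h2).
rewrite (cint_split (continuous_hslice (y:=y2) cq) h1 h2).
rewrite (cint_split (continuous_vslice (x:=x1) cq) h3 h4).
rewrite (cint_split (continuous_vslice (x:=x2) cq) h3 h4).
by ring.
Qed.

Lemma continuous_affine (p k : R[i]) : continuous (fun z : R[i]^o => p + k * z : R[i]^o).
Proof.
move=> z; apply: differentiable_continuous.
by apply: differentiableD => //; exact: differentiableM.
Qed.

Lemma boundary_int_affine (p k : R[i]) x1 x2 y1 y2 : x1 <= x2 -> y1 <= y2 ->
  boundary_int (fun z => p + k * z) x1 x2 y1 y2 = 0.
Proof.
move=> x12 y12; rewrite /boundary_int.
have hE y : (fun x : R => p + k * (x +i* y)) =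
            (fun x : R => (p + k * (0 +i* y)) + k * x%:C).
  by apply/funext => x; rewrite -addrA -mulrDr; simpc.
have vE x : (fun y : R => p + k * (x +i* y)) =
            (fun y : R => (p + k * x%:C) + (k * 'i%C) * y%:C).
  by apply/funext => y; rewrite -addrA -mulrA -mulrDr; simpc.
rewrite !hE !vE !cint_affine//.
by apply: ReImP; rewrite !(ReD, ImD, ReN, ImN, ReM, ImM) /=; field.
Qed.

(** Of the factor 4, one 2 comes from the perimeter and one from [cint_le]. *)
Lemma boundary_int_le q x1 x2 y1 y2 M : continuous q -> x1 <= x2 -> y1 <= y2 ->
  (forall x y, x1 <= x <= x2 -> y1 <= y <= y2 -> normc (q (x +i* y)) <= M) ->
  normc (boundary_int q x1 x2 y1 y2) <= 4 * M * ((x2 - x1) + (y2 - y1)).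
Proof.
move=> cq x12 y12 qM; rewrite /boundary_int.
have nh y : y1 <= y <= y2 -> normc (cint (fun x => q (x +i* y)) x1 x2) <= 2 * M * (x2 - x1).
  by move=> hy; apply: cint_le => // [|x hx]; [exact: continuous_hslice|exact: qM].
have nv x : x1 <= x <= x2 -> normc (cint (fun y => q (x +i* y)) y1 y2) <= 2 * M * (y2 - y1).
  by move=> hx; apply: cint_le => // [|y hy]; [exact: continuous_vslice|exact: qM].
have {}nh1 := nh y1; have {}nh2 := nh y2; have {}nv1 := nv x1; have {}nv2 := nv x2.
rewrite !lexx x12 y12 /= in nh1 nh2 nv1 nv2.
apply: le_trans (le_normcD _ _) _.
have -> : 4 * M * (x2 - x1 + (y2 - y1)) =
  (2 * M * (x2 - x1) + 2 * M * (x2 - x1)) + (2 * M * (y2 - y1) + 2 * M * (y2 - y1)).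
  by ring.
apply: lerD.
  by apply: le_trans (normcB_le _ _) _; apply: lerD; [exact: nh1|exact: nh2].
rewrite normcM (_ : normc 'i%C = 1) ?mul1r; last first.
  by rewrite /= expr0n expr1n add0r sqrtr1.
by apply: le_trans (normcB_le _ _) _; apply: lerD; [exact: nv2|exact: nv1].
Qed.

(** The bound e times the squared half-perimeter is additive under quartering, so [box_induction]
    reduces it to small rectangles. There the affine part of q at a point integrates to 0, and the
    remainder is small compared with the diameter. *)
Theorem Goursat q x1 x2 y1 y2 : (forall z, differentiable q z) ->
  x1 <= x2 -> y1 <= y2 -> boundary_int q x1 x2 y1 y2 = 0.
Proof.
move=> dq x12 y12.
have cq : continuous q by move=> z; exact: differentiable_continuous.
suff H e : 0 < e -> normc (boundary_int q x1 x2 y1 y2) <=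
    e * ((x2 - x1) + (y2 - y1)) ^+ 2.
  apply: eq0_normc; apply/eqP; rewrite eq_le normc_ge0 andbT.
  apply/ler_addgt0Pl => e e0; rewrite addr0.
  set S := ((x2 - x1) + (y2 - y1)) ^+ 2 in H.
  have S0 : 0 <= S by exact: sqr_ge0.
  apply: le_trans (H (e / (S + 1)) _) _; first by rewrite divr_gt0// ltr_wpDl.
  rewrite -mulrA ger_pMr// mulrC ler_pdivrMr ?mul1r ?lerDl//.
  by rewrite ltr_wpDl.
move=> e0; pose P a b c d := a <= b -> c <= d -> normc (boundary_int q a b c d) <=
    e * ((b - a) + (d - c)) ^+ 2.
suff : P x1 x2 y1 y2 by exact.
apply: (box_induction (P := P) x12 y12).
  move=> x y w h w0 h0 P1 P2 P3 P4 _ _.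
  rewrite (@boundary_int_split q x (x + w) (x + w + w) y (y + h) (y + h + h))
    ?lerDl//.
  have {}P1 := P1 (ltac:(by rewrite lerDl)) (ltac:(by rewrite lerDl)).
  have {}P2 := P2 (ltac:(by rewrite lerDl)) (ltac:(by rewrite lerDl)).
  have {}P3 := P3 (ltac:(by rewrite lerDl)) (ltac:(by rewrite lerDl)).
  have {}P4 := P4 (ltac:(by rewrite lerDl)) (ltac:(by rewrite lerDl)).
  have -> : e * ((x + w + w - x) + (y + h + h - y)) ^+ 2 =
    (e * ((x + w - x) + (y + h - y)) ^+ 2 + e * ((x + w - x) + (y + h + h - (y + h))) ^+ 2)
    + (e * ((x + w + w - (x + w)) + (y + h - y)) ^+ 2 +
       e * ((x + w + w - (x + w)) + (y + h + h - (y + h))) ^+ 2) by ring.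
  apply: le_trans (le_normcD _ _) _.
  by apply: lerD; apply: le_trans (le_normcD _ _) _; apply: lerD.
move=> x y.
pose p : R[i]^o := x +i* y.
have e4 : 0 < e / 4 by rewrite divr_gt0.
have [d d0 Hd] := differentiable_approx (dq p) e4.
(* Sides below d/2 keep the half-perimeter, which bounds the distance to p, below d; the e/4 above
   compensates the 4 of [boundary_int_le]. *)
exists (d / 2); first by rewrite divr_gt0.
move=> a1 a2 b1 b2 /andP[a1x xa2] /andP[b1y yb2] wd hd a12 b12.
pose k : R[i] := 'd q p 1.
have dE (h : R[i]^o) : 'd q p h = k * h.
  have -> : h = h *: (1 : R[i]^o) by rewrite /GRing.scale /= mulr1.
  by rewrite linearZ /= /GRing.scale /= mulr1 mulrC.
have cA : continuous (fun z : R[i]^o => (q p - k * p) + k * z : R[i]^o).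
  exact: continuous_affine.
have -> : boundary_int q a1 a2 b1 b2 =
    boundary_int (fun z => q z - ((q p - k * p) + k * z)) a1 a2 b1 b2.
  by rewrite boundary_intB// boundary_int_affine// subr0.
have -> : e * (a2 - a1 + (b2 - b1)) ^+ 2 =
    4 * (e / 4 * (a2 - a1 + (b2 - b1))) * (a2 - a1 + (b2 - b1)) by field.
apply: boundary_int_le; [|exact: a12|exact: b12|].
  by move=> z; apply: continuousB; [exact: cq|exact: cA].
move=> s t /andP[a1s sa2] /andP[b1t tb2].
have nh : normc ((s +i* t) - p) <= a2 - a1 + (b2 - b1).
  apply: le_trans (normc_le_ReIm _) _; rewrite /p /=; apply: lerD.
    by rewrite ler_norml; apply/andP; split; lra.
  by rewrite ler_norml; apply/andP; split; lra.
have := Hd ((s +i* t) - p); rewrite vnorm_complex [p + _]addrC subrK.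
have -> : q (s +i* t) - q p - 'd q p (s +i* t - p) =
    q (s +i* t) - ((q p - k * p) + k * (s +i* t)).
  by rewrite dE; ring.
move=> H; apply: le_trans (H _) _; last by rewrite ler_pM2l.
by apply: le_lt_trans nh _; lra.
Qed.

(* On a period rectangle the two horizontal sides cancel. *)
Lemma periodic_vslice_integral q (x1 x2 p : R) : (forall z, differentiable q z) ->
  x1 <= x2 -> 0 <= p -> (forall x, q (x +i* p) = q (x +i* 0)) ->
  cint (fun y => q (x1 +i* y)) 0 p = cint (fun y => q (x2 +i* y)) 0 p.
Proof.
move=> dq x12 p0 qp; have := Goursat dq x12 p0; rewrite /boundary_int.
have -> : (fun x => q (x +i* p)) = (fun x => q (x +i* 0)) by exact/funext.
rewrite subrr add0r => /eqP; rewrite mulf_eq0 => /orP[|].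
  by rewrite eq_complex /= oner_eq0 andbF.
by rewrite subr_eq0 => /eqP.
Qed.
End Goursat.

(** * Cauchy's formula and estimate *)

Section cexp.
Variable R : realType.
Implicit Types z w : R[i].

Lemma cexpD z w : cexp (z + w) = cexp z * cexp w.
Proof.
case: z w => a b [c d]; rewrite /cexp /= expRD cosD sinD; simpc.
by congr (_ +i* _); ring.
Qed.

Lemma cexp0 : cexp (0 : R[i]) = 1.
Proof. by rewrite /cexp /= expR0 cos0 sin0 mulr0 mulr1. Qed.

Lemma cexpNK z : cexp (- z) * cexp z = 1.
Proof. by rewrite -cexpD addNr cexp0. Qed.

Lemma cexp_neq0 z : cexp z != 0.
Proof.
by apply/eqP => e0; have := cexpNK z; rewrite e0 mulr0 => /eqP; rewrite eq_sym oner_eq0.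
Qed.

Lemma cexpN z : cexp (- z) = (cexp z)^-1.
Proof. by apply: (mulIf (cexp_neq0 z)); rewrite cexpNK mulVf// cexp_neq0. Qed.

Lemma normc_cexp z : normc (cexp z) = expR (Re z).
Proof.
rewrite /cexp /= !exprMn -mulrDr cos2Dsin2 mulr1 sqrtr_sqr ger0_norm//.
Qed.

Lemma cexp_mulrn z n : cexp (z *+ n) = cexp z ^+ n.
Proof.
by elim: n => [|n IH]; rewrite ?mulr0n ?cexp0 ?expr0// mulrS cexpD exprS IH.
Qed.

Lemma cexp_period (x y : R) : cexp (x +i* (y + pi *+ 2)) = cexp (x +i* y).
Proof. by rewrite /cexp /= cosD2pi sinD2pi. Qed.

Lemma cexp_near0 (e : R) : 0 < e -> exists2 d : R, 0 < d &
  forall h, normc h < d -> normc (cexp h - 1 - h) <= e * normc h.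
Proof.
(* 9 = (3 + 1) + (3 + 2): the coefficients of k n in the bounds for the real part ([T1], [H1]) and
   the imaginary part ([T2], [T3]). *)
move=> e0; have [k [k0 k1 k9]] : exists k : R, [/\ 0 < k, k <= 1 & 9 * k <= e].
  exists (Num.min 1 (e / 9)); split; first by rewrite lt_min ltr01 divr_gt0.
    by rewrite ge_min lexx.
  by rewrite mulrC -ler_pdivlMr// ge_min lexx orbT.
have [d1 d10 H1] := derive_approx (is_derive_expR (0 : R)) k0.
have [d2 d20 H2] := derive_approx (is_derive_cos (0 : R)) k0.
have [d3 d30 H3] := derive_approx (is_derive_sin (0 : R)) k0.
exists (Num.min (Num.min d1 d2) (Num.min d3 k)); first by rewrite 2!lt_min d10 d20 lt_min d30 k0.
case=> a b; rewrite !lt_min => /andP[/andP[hd1 hd2] /andP[hd3 hk]].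
set n : R := normc (a +i* b) in hd1 hd2 hd3 hk *.
have ha : `|a| <= n := Re_le_normc (a +i* b).
have hb : `|b| <= n := Im_le_normc (a +i* b).
have n0 : 0 <= n := normc_ge0 _.
have {H1} := H1 _ (le_lt_trans ha hd1); rewrite add0r expR0 mul1r => H1.
have {H2} := H2 _ (le_lt_trans hb hd2); rewrite add0r cos0 sin0 oppr0 mul0r subr0 => H2.
have {H3} := H3 _ (le_lt_trans hb hd3); rewrite add0r cos0 sin0 subr0 mul1r => H3.
have kn (x : R) : `|x| <= n -> k * `|x| <= k * n by move=> ?; rewrite ler_pM2l.
have {H1}H1 := le_trans H1 (kn _ ha).
have {H2}H2 := le_trans H2 (kn _ hb).
have {H3}H3 := le_trans H3 (kn _ hb).
have Ea : `|expR a - 1| <= 2 * n.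
  have -> : expR a - 1 = (expR a - 1 - a) + a by ring.
  apply: le_trans (ler_normD _ _) _.
  have : k * n <= n by exact: ler_piMl.
  by lra.
have Ea3 : `|expR a| <= 3.
  have -> : expR a = (expR a - 1) + 1 by rewrite subrK.
  apply: le_trans (ler_normD _ _) _; rewrite normr1.
  have := ltW (lt_le_trans hk k1); lra.
apply: le_trans (normc_le_ReIm _) _.
have -> : Re (cexp (a +i* b) - 1 - (a +i* b)) =
    expR a * (cos b - 1) + (expR a - 1 - a) by rewrite /=; ring.
have -> : Im (cexp (a +i* b) - 1 - (a +i* b)) =
    expR a * (sin b - b) + (expR a - 1) * b by rewrite /=; ring.
have T1 : `|expR a * (cos b - 1)| <= 3 * (k * n) by rewrite normrM; apply: ler_pM.
have T2 : `|expR a * (sin b - b)| <= 3 * (k * n) by rewrite normrM; apply: ler_pM.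
have T3 : `|(expR a - 1) * b| <= 2 * n * k.
  by rewrite normrM; apply: ler_pM => //; apply: le_trans hb (ltW hk).
have T4 := ler_normD (expR a * (cos b - 1)) (expR a - 1 - a).
have T5 := ler_normD (expR a * (sin b - b)) ((expR a - 1) * b).
apply: (@le_trans _ _ (9 * k * n)); last by rewrite ler_wpM2r.
by lra.
Qed.

Lemma is_diff_cexp (z : R[i]^o) :
  differentiable (@cexp R : R[i]^o -> R[i]^o) z /\
  forall h, 'd (@cexp R : R[i]^o -> R[i]^o) z h = cexp z * h.
Proof.
pose L := ( *:%R (cexp z) : R[i]^o -> R[i]^o).
have [||d dE] := @differentiable_of_approx R R[i]^o (@cexp R) z
  [the {linear R[i]^o -> R[i]^o} of *:%R (cexp z)] (normc (cexp z)).
- by move=> h; rewrite /= normcM vnorm_complex.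
- move=> e e0; have n0 : 0 < normc (cexp z) by rewrite normc_gt0 cexp_neq0.
  have [d d0 Hd] := cexp_near0 (divr_gt0 e0 n0); exists d => // h.
  rewrite vnorm_complex => /Hd H.
  have -> : cexp (z + h) - cexp z - cexp z *: h = cexp z * (cexp h - 1 - h).
    by rewrite /GRing.scale /= cexpD; ring.
  rewrite normcM mulrC -ler_pdivlMr//; apply: le_trans H _.
  by rewrite mulrAC.
- by split => // h; rewrite dE.
Qed.

End cexp.

(** In the Cauchy formula this removes the term [f z * cexp (- w)], which would blow up as Re w
    tends to -oo. *)
Lemma cint_cexpN_period (R : realType) (x : R) :
  cint (fun y => cexp (- (x +i* y))) 0 (pi *+ 2) = 0.
Proof.
have p0 : 0 <= pi *+ 2 :> R by rewrite mulrn_wge0// pi_ge0.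
have cF : continuous (fun y => cexp (- (x +i* y)) : R[i]^o).
  apply: (@continuous_vslice R (fun w => cexp (- w)) x) => w.
  apply: (@differentiable_continuous _ _ _ w
    ((@cexp R : R[i]^o -> R[i]^o) \o (-%R : R[i]^o -> R[i]^o))).
  apply: differentiable_comp => //; by case: (@is_diff_cexp R (- w)).
have dG (y : R) : is_derive y 1 (expR (- x) \*: (@sin R)) (Re (cexp (- (x +i* y)))).
  by apply: is_derive_eq; rewrite /cexp /= cosN.
have dH (y : R) : is_derive y 1 (expR (- x) \*: (@cos R)) (Im (cexp (- (x +i* y)))).
  by apply: is_derive_eq; rewrite /cexp /= sinN.
rewrite (cint_FTC p0 cF dG dH) /= /GRing.scale /=.
by rewrite sin0 cos0 -[pi *+ 2]add0r sinD2pi cosD2pi sin0 cos0 !subrr.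
Qed.

Section Cauchy.
Variables (R : realType) (V : normedModType R[i]).
Implicit Types (f : V -> R[i]^o) (z v : V).

Lemma differentiable_line f z v (g : R[i]^o -> R[i]^o) :
  (forall z, differentiable f z) -> (forall t, differentiable g t) ->
  forall t, differentiable (fun t : R[i]^o => f (z + g t *: v)) t.
Proof.
move=> df dg t.
apply: (@differentiable_comp _ _ _ _ (fun t : R[i]^o => z + g t *: v) f) => //.
apply: differentiableD => //; exact: differentiableZl.
Qed.

Lemma Cauchy_formula f z v : (forall z, differentiable f z) ->
  cint (fun t => f (z + cexp (0 +i* t) *: v) * cexp (- (0 +i* t))) 0 (pi *+ 2) =
  'd f z v * (pi *+ 2)%:C.
Proof.
move=> df.
pose q (w : R[i]^o) : R[i]^o := f (z + cexp w *: v) * cexp (- w).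
have dcexp (w : R[i]^o) : differentiable (@cexp R : R[i]^o -> R[i]^o) w.
  by case: (is_diff_cexp w).
have dcexpN (w : R[i]^o) :
  differentiable ((@cexp R : R[i]^o -> R[i]^o) \o (-%R : R[i]^o -> R[i]^o)) w.
  exact: differentiable_comp.
have dq w : differentiable q w.
  exact: (differentiableM (differentiable_line z v df dcexp w) (dcexpN w)).
have cq : continuous q by move=> w; exact: differentiable_continuous.
have p0 : 0 <= pi *+ 2 :> R by rewrite mulrn_wge0// pi_ge0.
have qper (x : R) : q (x +i* (pi *+ 2)) = q (x +i* 0).
  by rewrite /q !cexpN -[pi *+ 2]add0r cexp_period.
rewrite -[LHS]/(cint (fun t => q (0 +i* t)) 0 (pi *+ 2)).
have IE (x : R) (x0 : x <= 0) := periodic_vslice_integral dq x0 p0 qper.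
apply/eqP; rewrite -subr_eq0 -normc_eq0 eq_le normc_ge0 andbT.
apply/ler_addgt0Pl => e e0; rewrite addr0.
(* Dominates [2 * vnorm v * (pi *+ 2)], the factor by which [cint_le] multiplies the accuracy e /
   C. *)
pose C := 2 * (vnorm v + 1) * (pi *+ 2) + 1.
have C0 : 0 < C.
  by rewrite ltr_wpDl// mulr_ge0// mulr_ge0// addr_ge0// vnorm_ge0.
have [d d0 Hd] := differentiable_approx (df z) (divr_gt0 e0 C0).
have v1 : 0 < vnorm v + 1 by rewrite ltr_wpDl// vnorm_ge0.
(* So far to the left that the displacement [cexp w *: v], of size [expR x * vnorm v], is below d;
   the minimum with 0 allows [IE] to move the integral there from abscissa 0. *)
pose x := Num.min 0 (ln (d / (vnorm v + 1))).
have x0 : x <= 0 by rewrite ge_min lexx.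
have ex : expR x * vnorm v < d.
  have xd : expR x <= d / (vnorm v + 1).
    rewrite -[leRHS]lnK ?posrE ?divr_gt0// ler_expR /x ge_min.
    by rewrite lexx orbT.
  apply: le_lt_trans (_ : d / (vnorm v + 1) * vnorm v < d).
    by rewrite ler_wpM2r// vnorm_ge0.
  by rewrite -mulrA gtr_pMr// mulrC ltr_pdivrMr// mul1r ltrDl.
rewrite -(IE x x0).
have cE : continuous (fun y => cexp (- (x +i* y)) : R[i]^o).
  exact: (@continuous_vslice R (fun w => cexp (- w)) x
    (fun w => differentiable_continuous (dcexpN w))).
have cc (c : R[i]) : continuous (fun _ : R => c : R[i]^o).
  by move=> ?; exact: cvg_cst.
have cfE : continuous (fun y => f z * cexp (- (x +i* y)) : R[i]^o).
  by move=> y; apply: continuousM (cE y); exact: cc.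
have cfED : continuous (fun y => f z * cexp (- (x +i* y)) + 'd f z v : R[i]^o).
  by move=> y; apply: continuousD (cfE y) _; exact: cc.
(* The first-order expansion of f (z + e^w v), times e^(-w), is f z e^(-w) + 'd f z v; the first
   term has integral 0 over a period. *)
have -> : 'd f z v * (pi *+ 2)%:C =
    cint (fun y => f z * cexp (- (x +i* y)) + 'd f z v) 0 (pi *+ 2).
  rewrite (cintD 0 (pi *+ 2) cfE (cc ('d f z v))) (cintZ (f z) 0 (pi *+ 2) cE).
  by rewrite cint_cexpN_period mulr0 add0r (cint_cst _ p0) subr0.
rewrite -(cintB 0 (pi *+ 2) (continuous_vslice (x := x) cq) cfED).
apply: (@le_trans _ _ (2 * (e / C * vnorm v) * (pi *+ 2 - 0))); last first.
  rewrite subr0.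
  have -> : 2 * (e / C * vnorm v) * (pi *+ 2) = e * (2 * vnorm v * (pi *+ 2) / C).
    by field; rewrite gt_eqF.
  rewrite ger_pMr// ler_pdivrMr// mul1r /C.
  have : 0 <= 2 * (pi *+ 2) :> R by rewrite mulr_ge0.
  by move: (pi *+ 2) => p ?; lra.
apply: cint_le; [|exact: p0|].
  exact: (continuous_sub (continuous_vslice (x := x) cq) cfED).
move=> y _.
set h := cexp (x +i* y).
have hn : normc h = expR x by rewrite normc_cexp.
have -> : q (x +i* y) - (f z * cexp (- (x +i* y)) + 'd f z v) =
    (f (z + h *: v) - f z - 'd f z (h *: v)) * h^-1.
  rewrite /q cexpN -/h linearZ /= /GRing.scale /=.
  by field; exact: cexp_neq0.
rewrite normcM normcV ler_pdivrMr ?hn ?expR_gt0//.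
have := Hd (h *: v); rewrite vnormZ hn => /(_ ex) H.
by apply: le_trans H _; rewrite [expR x * _]mulrC mulrA.
Qed.

(** The radius is 1 because v carries the scale: radius s is obtained with [s%:C *: v] and the
    linearity of the differential. *)
Lemma Cauchy_estimate f z v M : (forall z, differentiable f z) ->
  (forall t : R[i], normc t = 1 -> normc (f (z + t *: v)) <= M) ->
  normc ('d f z v) <= 2 * M.
Proof.
move=> df fM.
have p0 : 0 < pi *+ 2 :> R by rewrite mulrn_wgt0// pi_gt0.
have : normc ('d f z v * (pi *+ 2)%:C) <= 2 * M * (pi *+ 2).
  rewrite -Cauchy_formula// -[leRHS]/(2 * M * (pi *+ 2)) -[in leRHS](subr0 (pi *+ 2)).
  apply: cint_le; [|exact: ltW|].
  - apply: (@continuous_vslice R (fun w => f (z + cexp w *: v) * cexp (- w))) => w.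
    apply: differentiable_continuous.
    apply: (differentiableM (f := fun w : R[i]^o => f (z + cexp w *: v))
      (g := (@cexp R : R[i]^o -> R[i]^o) \o (-%R : R[i]^o -> R[i]^o))).
      by apply: differentiable_line => // t; case: (is_diff_cexp t).
    by apply: differentiable_comp => //; case: (@is_diff_cexp R (- w)).
  - move=> y _; rewrite normcM !normc_cexp /= oppr0 expR0 mulr1.
    by apply: fM; rewrite normc_cexp expR0.
rewrite normcM normc_real ger0_norm; last exact: ltW. by rewrite ler_pM2r.
Qed.

End Cauchy.

(** * Regularity of the derivative *)

Lemma is_derive_of_approx (R : realType) (g : R -> R) (x dg : R) :
  (forall e : R, 0 < e -> exists2 d : R, 0 < d &
    forall h, `|h| < d -> `|g (x + h) - g x - dg * h| <= e * `|h|) ->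
  is_derive x 1 g dg.
Proof.
move=> H.
have cv : ((fun h : R => h^-1 *: ((g \o shift x) (h *: (1 : R)) - g x)) @ 0^' --> dg)%classic.
  apply/(@cvgrPdist_le _ _ _ (dnbhs (0 : R))) => e e0; have [d d0 Hd] := H e e0.
  near=> h.
  have hn0 : h != 0 by near: h; exact: nbhs_dnbhs_neq.
  have hd : `|h| < d by near: h; exact: dnbhs0_lt.
  have := Hd h hd; rewrite /shift /= /GRing.scale /= mulr1 [h + x]addrC.
  have -> : dg - h^-1 * (g (x + h) - g x) = - (h^-1 * (g (x + h) - g x - dg * h)).
    by field.
  by rewrite normrN normrM normfV ler_pdivrMl ?normr_gt0// [`|h| * _]mulrC.
by split; [apply/cvg_ex; exists dg | exact: cvg_lim cv].
Unshelve. all: by end_near. Qed.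

Section local.
Variables (R : realType) (V : normedModType R[i]).
Implicit Types (f : V -> R[i]^o) (x y z v h k : V).

Lemma diff_scale f z (a : R[i]) h : 'd f z (a *: h) = a * 'd f z h.
Proof. by rewrite linearZ. Qed.

(** The real mean value theorem is applied to Re and Im along the segment. With c = 0 this bounds
    increments, with c = 'd f z h the Taylor remainder. *)
Lemma mean_value_bound f z h (c : R[i]) M : (forall z, differentiable f z) ->
  (forall s : R, 0 <= s <= 1 -> normc ('d f (z + s%:C *: h) h - c) <= M) ->
  normc (f (z + h) - f z - c) <= 2 * M.
Proof.
move=> df fM.
have part (p : R[i] -> R) : (forall w, `|p w| <= normc w) ->
    (forall a b, p (a - b) = p a - p b) -> (forall (r : R) a, p (r%:C * a) = r * p a) ->
    `|p (f (z + h) - f z - c)| <= M.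
  move=> pn pB pZ.
  have dp (s : R) : is_derive s 1 (fun s => p (f (z + s%:C *: h)))
      (p ('d f (z + s%:C *: h) h)).
    apply: is_derive_of_approx => e e0.
    have h1 : 0 < vnorm h + 1 by rewrite ltr_wpDl// vnorm_ge0.
    have [d d0 Hd] := differentiable_approx (df (z + s%:C *: h)) (divr_gt0 e0 h1).
    exists (d / (vnorm h + 1)); first by rewrite divr_gt0.
    move=> t td; have := Hd (t%:C *: h); rewrite vnormZ normc_real => H.
    have -> : p (f (z + (s + t)%:C *: h)) - p (f (z + s%:C *: h)) -
        p ('d f (z + s%:C *: h) h) * t =
        p (f (z + s%:C *: h + t%:C *: h) - f (z + s%:C *: h)
          - 'd f (z + s%:C *: h) (t%:C *: h)).
      rewrite (diff_scale _ _ t%:C) !pB pZ [_ * t]mulrC.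
      by rewrite (_ : (s + t)%:C = s%:C + t%:C) ?rmorphD// scalerDl addrA.
    apply: le_trans (pn _) _; apply: le_trans (H _) _.
      rewrite ltr_pdivlMr// in td; apply: le_lt_trans td.
      by rewrite ler_wpM2l// lerDl.
    have -> : e / (vnorm h + 1) * (`|t| * vnorm h) =
      e * `|t| * (vnorm h / (vnorm h + 1)) by field; rewrite gt_eqF.
    rewrite ler_piMr ?mulr_ge0//; first exact: ltW.
    by rewrite ler_pdivrMr// mul1r lerDl.
  have [s] := @MVT_segment R (fun s : R => p (f (z + s%:C *: h)))
    (fun s : R => p ('d f (z + s%:C *: h) h)) 0 1 ler01 (fun s _ => dp s)
    (continuous_subspaceT (fun s => differentiable_continuous
      (proj1 (derivable1_diffP _ _) (@ex_derive _ _ _ _ _ _ _ (dp s))))).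
  rewrite in_itv /= => /fM s01; rewrite scale0r addr0 scale1r subr0 mulr1 => E.
  by rewrite !pB E -pB; apply: le_trans (pn _) _.
apply: le_trans (normc_le_ReIm _) _; rewrite mulr2n mulrDl mul1r; apply: lerD.
  apply: (part (fun w => Re w)) => [w|a b|r a]; [exact: Re_le_normc|exact: ReB|].
  by rewrite ReM /= mul0r subr0.
apply: (part (fun w => Im w)) => [w|a b|r a]; [exact: Im_le_normc|exact: ImB|].
by rewrite ImM /= mul0r addr0.
Qed.

Lemma differentiable_shift f k : (forall z, differentiable f z) ->
  forall z, differentiable (fun w : V => f (w + k)) z.
Proof.
move=> df z; apply: (@differentiable_comp _ _ _ _ (fun w : V => w + k) f) => //.
Qed.

Lemma diff_increment f y h k : (forall z, differentiable f z) ->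
  'd (fun w : V => f (w + k) - f w) y h = 'd f (y + k) h - 'd f y h.
Proof.
move=> df; have dS := differentiable_shift k df.
have dI : differentiable (fun w : V => f (w + k) - f w) y.
  exact: (differentiableB (dS y) (df y)).
have E1 := deriveE h dI.
have E2 := deriveE h (df (y + k)).
have E3 := deriveE h (df y).
have EB := deriveB (diff_derivable (v := h) (dS y)) (diff_derivable (v := h) (df y)).
apply: (etrans (esym E1)).
apply: (etrans EB).
rewrite E3 -E2 /derive.
have -> : (fun w : V => f (w + k)) \o shift y = f \o shift (y + k).
  by apply/funext => w; rewrite /= addrA.
by [].
Qed.

(* Applying the Cauchy estimate to [w |-> f (w + t h) - f w] makes the derivative
   Lipschitz, and hence the Taylor remainder quadratic. *)
Lemma line_bounds f y h M (t : R[i]) : (forall z, differentiable f z) ->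
  (forall s : R[i], normc s <= 4 -> normc (f (y + s *: h)) <= M) ->
  normc t <= 1 ->
  normc (f (y + t *: h) - f y) <= 4 * M * normc t /\
  normc (f (y + t *: h) - f y - 'd f y (t *: h)) <= 16 * M * normc t ^+ 2.
Proof.
move=> df fM t1.
have t0 := normc_ge0 t.
(* Radius budget: a unit circle around a point with |s| <= 3 stays in radius 4, and a step of length
   at most 1 from |s| <= 2 stays in radius 3. Each Cauchy or mean value estimate doubles the
   constant, hence 2, 4, 8, 16. *)
have c1 (s : R[i]) : normc s <= 3 -> normc ('d f (y + s *: h) h) <= 2 * M.
  move=> s3; apply: (Cauchy_estimate df) => r r1.
  rewrite -addrA -scalerDl; apply: fM; apply: le_trans (le_normcD _ _) _.
  by rewrite r1; lra.
have M0 : 0 <= M.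
  apply: le_trans (normc_ge0 _) (fM 0 _); rewrite normc0; lra.
have c2 (r s : R[i]) : normc r <= 1 -> normc s <= 2 ->
    normc (f (y + s *: h + r *: h) - f (y + s *: h)) <= 4 * M * normc r.
  move=> r1 s2; have r0 := normc_ge0 r.
  have -> : 4 * M * normc r = 2 * (2 * M * normc r) by ring.
  rewrite -[X in normc X]subr0; apply: (mean_value_bound df) => a /andP[a0 a1].
  rewrite subr0 diff_scale normcM mulrC ler_wpM2r//.
  rewrite scalerA -addrA -scalerDl; apply: c1.
  apply: le_trans (le_normcD _ _) _; rewrite normcM normc_real ger0_norm//.
  have : a * normc r <= 1 by rewrite -(mulr1 1) ler_pM.
  by lra.
have c3 (r : R[i]) : normc r <= 1 ->
    normc ('d f (y + r *: h) h - 'd f y h) <= 8 * M * normc r.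
  move=> r1.
  pose F w := f (w + r *: h) - f w.
  have dF w : differentiable F w.
    exact: (differentiableB (differentiable_shift (r *: h) df w) (df w)).
  rewrite -(diff_increment y h (r *: h) df).
  have -> : 8 * M * normc r = 2 * (4 * M * normc r) by ring.
  apply: (Cauchy_estimate dF) => s s1.
  by rewrite /F; apply: c2 => //; rewrite s1; lra.
split.
  by have := c2 t 0 t1; rewrite scale0r !addr0 normc0; apply; lra.
have -> : 16 * M * normc t ^+ 2 = 2 * (8 * M * normc t * normc t) by ring.
apply: (mean_value_bound df) => a /andP[a0 a1].
rewrite !diff_scale -mulrBr normcM mulrC ler_wpM2r//.
rewrite scalerA; apply: le_trans (c3 _ _) _.
  rewrite normcM normc_real ger0_norm//.
  by rewrite -(mulr1 1) ler_pM.
rewrite normcM normc_real ger0_norm// -!mulrA ler_wpM2l// ler_wpM2l//.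
by rewrite ler_piMl.
Qed.

End local.

Section derivative_entire.
Variables (R : realType) (V : normedModType R[i]).
Implicit Types (f : V -> R[i]^o) (x y z v h k : V).

(** M bounds f on the ball of radius d around z. A vector k is written as t h with |h| = d/10, so
    that |y - z| + 4 |h| < d and [line_bounds] applies. The point is the uniformity in y and in the
    direction of k. *)
Lemma local_bounds f z : (forall z, differentiable f z) ->
  exists rho C : R, [/\ 0 < rho, 0 <= C &
    forall y k, vnorm (y - z) < rho -> vnorm k < rho ->
      normc (f (y + k) - f y) <= C * vnorm k /\
      normc (f (y + k) - f y - 'd f y k) <= C * vnorm k ^+ 2].
Proof.
move=> df; have [d d0 Hd] := continuous_approx (df z) (@ltr01 R).
pose M := normc (f z) + 1.
have M0 : 0 <= M by rewrite addr_ge0// normc_ge0.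
pose a := d / 10; have a0 : 0 < a by rewrite divr_gt0.
exists a, (4 * M / a + 16 * M / a ^+ 2).
have c1 : 0 <= 4 * M / a by rewrite divr_ge0 ?mulr_ge0// ltW.
have c2 : 0 <= 16 * M / a ^+ 2 by rewrite divr_ge0 ?mulr_ge0// ?exprn_ge0 ?ltW.
split => //; first exact: addr_ge0.
move=> y k yz ka.
have [->|k0] := eqVneq k 0.
  by rewrite addr0 subrr vnorm0 linear0 subr0 normc0 expr0n /= !mulr0.
have nk : 0 < vnorm k by rewrite vnorm_gt0.
pose t : R[i] := (vnorm k / a)%:C.
pose h := (a / vnorm k)%:C *: k.
have th : k = t *: h.
  rewrite /h scalerA -rmorphM /= (_ : _ * _ = 1) ?scale1r//.
  by field; rewrite !gt_eqF.
have hn : vnorm h = a.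
  rewrite vnormZ normc_real ger0_norm ?divr_ge0 ?ltW// divfK// gt_eqF//.
have tn : normc t = vnorm k / a.
  by rewrite normc_real ger0_norm// divr_ge0 ?ltW.
have t1 : normc t <= 1 by rewrite tn ler_pdivrMr// mul1r ltW.
have fM (s : R[i]) : normc s <= 4 -> normc (f (y + s *: h)) <= M.
  move=> s4.
  have : vnorm (y + s *: h - z) < d.
    rewrite addrAC; apply: le_lt_trans (vnormD _ _) _; rewrite vnormZ hn.
    have : normc s * a <= 4 * a by rewrite ler_pM2r.
    by move: yz a0; rewrite /a; lra.
  move=> /Hd; rewrite [z + _]addrC subrK => /ltW H.
  have -> : f (y + s *: h) = f z + (f (y + s *: h) - f z) by rewrite [RHS]addrC subrK.
  by apply: le_trans (le_normcD _ _) _; rewrite lerD2l.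
have [] := line_bounds df fM t1; rewrite -th tn => H1 H2; split.
  apply: le_trans H1 _; rewrite [leLHS](_ : _ = 4 * M / a * vnorm k); last by ring.
  by apply: ler_wpM2r; rewrite ?vnorm_ge0// lerDl.
apply: le_trans H2 _; rewrite expr_div_n.
rewrite [leLHS](_ : _ = 16 * M / a ^+ 2 * vnorm k ^+ 2); last by ring.
by apply: ler_wpM2r; rewrite ?exprn_ge0 ?vnorm_ge0// lerDr.
Qed.

(* The Cauchy estimate for the increment [w |-> f (w + k) - f w]. *)
Lemma continuous_diff f h : (forall z, differentiable f z) ->
  continuous (fun w => 'd f w h : R[i]^o).
Proof.
move=> df z; apply/(@cvgrPdist_lt _ _ _ (nbhs z)) => e e0.
have eE : e = (Re e)%:C by rewrite RRe_real// ger0_real// ltW.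
have {e0}e0 : 0 < Re e by rewrite -ltcR -eE.
have [rho [C [rho0 C0 HC]]] := local_bounds z df.
(* With this scaling the points z + t a h, |t| = 1, stay within rho of z, where [HC] holds. *)
pose a := rho / (2 * (vnorm h + 1)).
have h1 : 0 < vnorm h + 1 by rewrite ltr_wpDl// vnorm_ge0.
have a0 : 0 < a by rewrite divr_gt0// mulr_gt0.
pose b := 2 * C / a + 1.
have b0 : 0 < b.
  by rewrite ltr_wpDl//; apply: divr_ge0; [exact: mulr_ge0|exact: ltW].
pose m := Num.min rho (Re e / b).
have m0 : 0 < m by rewrite lt_min rho0 divr_gt0.
apply/nbhs_normP; exists m%:C; first by change (0 < m%:C); rewrite ltcR.
move=> w /=; rewrite -normrN opprB normvE ltcR lt_min => /andP[wr wb].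
rewrite normcE eE ltcR normcB_sym.
pose k := w - z.
have zk : z + k = w by rewrite /k addrC subrK.
have := diff_increment z h k df; rewrite zk => <-.
suff H : normc ('d (fun w => f (w + k) - f w) z h) * a <= 2 * (C * vnorm k).
  have : normc ('d (fun w => f (w + k) - f w) z h) <= vnorm k * (2 * C / a).
    rewrite -ler_pdivlMr// in H; apply: le_trans H _; rewrite le_eqVlt.
    by apply/orP; left; apply/eqP; field; rewrite gt_eqF.
  move=> H'; apply: le_lt_trans H' _.
  rewrite ltr_pdivlMr// in wb; apply: le_lt_trans wb.
  by rewrite ler_wpM2l ?vnorm_ge0// lerDl.
have -> : normc ('d (fun w => f (w + k) - f w) z h) * a =
    normc ('d (fun w => f (w + k) - f w) z (a%:C *: h)).
  by rewrite diff_scale normcM normc_real ger0_norm ?ltW// mulrC.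
apply: Cauchy_estimate.
  by move=> y; exact: (differentiableB (differentiable_shift k df y) (df y)).
move=> t t1; apply: (HC _ _ _ wr).1.
rewrite addrAC subrr add0r !vnormZ t1 mul1r normc_real ger0_norm ?ltW//.
rewrite /a -mulrA -[ltRHS]mulr1 ltr_pM2l// mulrC ltr_pdivrMr ?mulr_gt0//.
by have := vnorm_ge0 h; lra.
Qed.

(** The differential at a vector of length rho/2 is the difference of the two controlled quantities;
    homogeneity does the rest. The bound depends on y only through rho and C, so it can be
    integrated over a circle of base points. *)
Lemma local_diff_bound f y rho C : 0 < rho -> 0 <= C ->
  (forall k, vnorm k < rho -> normc (f (y + k) - f y) <= C * vnorm k /\
      normc (f (y + k) - f y - 'd f y k) <= C * vnorm k ^+ 2) ->
  forall h, normc ('d f y h) <= C * (1 + rho) * vnorm h.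
Proof.
move=> rho0 C0 HC h; have [->|h0] := eqVneq h 0.
  by rewrite linear0 normc0 vnorm0 mulr0.
have nh : 0 < vnorm h by rewrite vnorm_gt0.
pose a := rho / (2 * vnorm h); have a0 : 0 < a by rewrite divr_gt0// mulr_gt0.
have ah : a * vnorm h = rho / 2 by rewrite /a; field; rewrite gt_eqF.
pose k := a%:C *: h.
have nk : vnorm k = a * vnorm h by rewrite vnormZ normc_real ger0_norm// ltW.
have [|H1 H2] := HC k; first by rewrite nk ah; lra.
have kE : normc ('d f y k) <= C * vnorm k + C * vnorm k ^+ 2.
  have -> : 'd f y k = (f (y + k) - f y) - (f (y + k) - f y - 'd f y k).
    by rewrite opprB addrC subrK.
  exact: le_trans (normcB_le _ _) (lerD H1 H2).
rewrite -(ler_pM2l a0).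
have -> : a * normc ('d f y h) = normc ('d f y k).
  by rewrite diff_scale normcM normc_real ger0_norm// ltW.
have -> : a * (C * (1 + rho) * vnorm h) = C * ((1 + rho) * vnorm k) by rewrite nk; ring.
apply: le_trans kE _; rewrite -mulrDr ler_wpM2l//.
rewrite expr2 mulrDl mul1r lerD2l ler_wpM2r ?vnorm_ge0// nk ah; lra.
Qed.

(* The candidate differential of [w |-> 'd f w v] is the Cauchy integral of
   ['d f (z + e^(it) v) h], which is visibly linear in [h]. *)
Lemma differentiable_diff_small f z v rho C : (forall z, differentiable f z) ->
  0 < rho -> 0 <= C -> vnorm v < rho ->
  (forall y k, vnorm (y - z) < rho -> vnorm k < rho ->
      normc (f (y + k) - f y) <= C * vnorm k /\
      normc (f (y + k) - f y - 'd f y k) <= C * vnorm k ^+ 2) ->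
  differentiable (fun w => 'd f w v : R[i]^o) z.
Proof.
move=> df rho0 C0 vr HC.
have pi0 : 0 < pi *+ 2 :> R by rewrite mulrn_wgt0// pi_gt0.
pose p : R[i] := (pi *+ 2)%:C.
have p0 : p != 0 by rewrite -normc_eq0 normc_real normr_eq0 gt_eqF.
have np : normc p = pi *+ 2 by rewrite normc_real gtr0_norm.
pose E (t : R) : R[i]^o := cexp (- (0 +i* t)).
pose y (t : R) := z + cexp (0 +i* t) *: v.
have nE t : normc (E t) = 1 by rewrite normc_cexp /= oppr0 expR0.
have dcexp (w : R[i]^o) : differentiable (@cexp R : R[i]^o -> R[i]^o) w.
  by case: (is_diff_cexp w).
have cE : continuous E.
  apply: (@continuous_vslice R (fun w => cexp (- w))) => w.
  apply: (@differentiable_continuous _ _ _ w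
    ((@cexp R : R[i]^o -> R[i]^o) \o (-%R : R[i]^o -> R[i]^o))).
  by apply: differentiable_comp; [|exact: dcexp].
have cfy (g : V -> R[i]^o) : continuous g -> continuous (fun t => g (y t)).
  move=> cg t.
  have cy : continuous y.
    move=> s; apply: (@continuous_comp _ _ _ (fun s : R => 0 +i* s : R[i]^o)
      (fun w : R[i]^o => z + cexp w *: v)); first exact: continuous_vertical.
    apply: differentiable_continuous.
    by apply: differentiableD; [exact: differentiable_cst|exact: differentiableZl].
  exact: (continuous_comp (cy t) (cg _)).
have cprod (g : V -> R[i]^o) : continuous g -> continuous (fun t => g (y t) * E t : R[i]^o).
  by move=> cg t; apply: continuousM; [exact: cfy|exact: cE].
have cf (k : V) : continuous (fun w => f (w + k)).
  by move=> w; exact: differentiable_continuous (differentiable_shift k df w).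
have cd (h : V) := cprod _ (continuous_diff (h := h) df).
have yz t : vnorm (y t - z) < rho.
  by rewrite /y addrAC subrr add0r vnormZ normc_cexp /= expR0 mul1r.
pose Lf h : R[i]^o := p^-1 * cint (fun t => 'd f (y t) h * E t) 0 (pi *+ 2).
have Llin : linear Lf.
  move=> a h k; rewrite /Lf.
  have -> : (fun t => 'd f (y t) (a *: h + k) * E t) =
    (fun t => a * ('d f (y t) h * E t) + 'd f (y t) k * E t).
    by apply/funext => t; rewrite linearD /= diff_scale mulrDl mulrA.
  have cad := continuous_cmul (c := a) (cd h).
  rewrite (cintD _ _ cad (cd k)) (cintZ _ _ _ (cd h)).
  by rewrite /GRing.scale /=; ring.
pose L : {linear V -> R[i]^o} := HB.pack Lf (GRing.isLinear.Build _ _ _ _ Lf Llin).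
have [||//] := @differentiable_of_approx R V (fun w => 'd f w v : R[i]^o) z L
    (2 * (C * (1 + rho))).
- move=> h; rewrite -[L h]/(Lf h) /Lf normcM normcV np ler_pdivrMl//.
  have -> : (pi *+ 2) * (2 * (C * (1 + rho)) * vnorm h) =
    2 * (C * (1 + rho) * vnorm h) * (pi *+ 2 - 0) by rewrite subr0; ring.
  apply: cint_le; [exact: cd|exact: ltW|] => t _.
  rewrite normcM nE mulr1; apply: local_diff_bound => //.
  by move=> k kr; apply: HC.
move=> e e0; pose d := Num.min rho (e / (2 * C + 1)).
have C1 : 0 < 2 * C + 1 by rewrite ltr_wpDl// mulr_ge0.
exists d; first by rewrite lt_min rho0 divr_gt0.
move=> h; rewrite lt_min => /andP[hr hd]; rewrite -[L h]/(Lf h).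
(* By the Cauchy formula at z + h and at z, the error is the integral of the Taylor remainders of f
   at the points y t with increment h. Each is at most C |h|^2, uniformly in t, so the integral is
   o(|h|). *)
suff H : normc (p * ('d f (z + h) v - 'd f z v - Lf h)) <=
    2 * (C * vnorm h ^+ 2) * (pi *+ 2 - 0).
  move: H; rewrite normcM np subr0 mulrC ler_pM2r// => H; apply: le_trans H _.
  rewrite expr2 !mulrA ler_wpM2r ?vnorm_ge0//.
  rewrite ltr_pdivlMr// mulrC in hd; apply: le_trans (ltW hd).
  by rewrite ler_wpM2r ?vnorm_ge0// lerDl.
have -> : p * ('d f (z + h) v - 'd f z v - Lf h) =
    cint (fun t => f (y t + h) * E t - f (y t) * E t - 'd f (y t) h * E t) 0 (pi *+ 2).
  have cf0 : continuous (fun t => f (y t) * E t : R[i]^o).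
    by apply: cprod => w; exact: differentiable_continuous.
  have cfh := cprod _ (cf h).
  rewrite (cintB _ _ (continuous_sub cfh cf0) (cd h)) (cintB _ _ cfh cf0).
  have E1 := Cauchy_formula (z + h) v df.
  have E0 := Cauchy_formula z v df.
  have -> : cint (fun t => f (y t + h) * E t) 0 (pi *+ 2) = 'd f (z + h) v * p.
    by rewrite -E1; congr cint; apply/funext => t; rewrite /y addrAC.
  have -> : cint (fun t => f (y t) * E t) 0 (pi *+ 2) = 'd f z v * p by [].
  have -> : cint (fun t => 'd f (y t) h * E t) 0 (pi *+ 2) = p * Lf h.
    by rewrite /Lf mulrA mulfV// mul1r.
  by ring.
apply: cint_le; [|exact: ltW|].
  have cf0 : continuous (fun t => f (y t) * E t : R[i]^o).
    by apply: cprod => w; exact: differentiable_continuous.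
  exact: (continuous_sub (continuous_sub (cprod _ (cf h)) cf0) (cd h)).
move=> t _; rewrite -!mulrBl normcM nE mulr1.
by case: (HC (y t) h (yz t) hr).
Qed.

(** By homogeneity v may be shrunk until the circle z + e^(it) v lies where the local bounds
    hold. *)
Lemma differentiable_diff f v : (forall z, differentiable f z) ->
  forall z, differentiable (fun w => 'd f w v : R[i]^o) z.
Proof.
move=> df z; have [rho [C [rho0 C0 HC]]] := local_bounds z df.
have v1 : 0 < vnorm v + 1 by rewrite ltr_wpDl// vnorm_ge0.
pose a : R := rho / (vnorm v + 1); have a0 : 0 < a by rewrite divr_gt0.
have small : vnorm (a%:C *: v) < rho.
  rewrite vnormZ normc_real gtr0_norm// /a -mulrA -[ltRHS]mulr1 ltr_pM2l//.
  by rewrite mulrC ltr_pdivrMr// mul1r ltrDl.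
have dv := differentiable_diff_small df rho0 C0 small HC.
have aC : a%:C != 0 by rewrite -normc_eq0 normc_real normr_eq0 gt_eqF.
have -> : (fun w => 'd f w v : R[i]^o) = (a%:C)^-1 *: (fun w => 'd f w (a%:C *: v) : R[i]^o).
  apply/funext => w; rewrite -[RHS]/((a%:C)^-1 * 'd f w (a%:C *: v)).
  by rewrite diff_scale mulrA mulVf// mul1r.
exact: differentiableZ.
Qed.

End derivative_entire.

(** * Growth of the solutions *)

(** The coordinate-free counterpart of [dpartial], meaningful in any V; by [dpartialE] they agree on
    entire functions. *)
Definition dird (R : realType) (V : normedModType R[i]) (u : V)
  (f : V -> R[i]^o) : V -> R[i]^o := fun z => 'd f z u.

Lemma dpartialE (R : realType) (m : nat) (u : 'rV[R[i]]_m) (f : 'rV[R[i]]_m -> R[i]^o) :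
  entire f -> dpartial u f = dird u f.
Proof.
move=> df; apply/funext => z; rewrite /dpartial /dird.
rewrite [in RHS](row_sum_delta u) linear_sum; apply: eq_bigr => j _.
by rewrite diff_scale /partial deriveE.
Qed.

Section growth.
Variables (R : realType) (V : normedModType R[i]).
Implicit Types (f : V -> R[i]^o) (u z : V).

Lemma differentiable_iter_dird f u l : (forall z, differentiable f z) ->
  forall z, differentiable (iter l (dird u) f) z.
Proof.
move=> df; elim: l => // l IH z; rewrite iterS; exact: differentiable_diff.
Qed.

(** The radius l s is spent in l steps of radius s, one per derivative, and each Cauchy estimate
    costs a factor 2 / s. *)
Lemma iter_dird_bound f u (s M : R) l z : (forall z, differentiable f z) -> 0 < s ->
  (forall t : R[i], normc t <= l%:R * s -> normc (f (z + t *: u)) <= M) ->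
  normc (iter l (dird u) f z) <= (2 / s) ^+ l * M.
Proof.
move=> df s0; elim: l z => [|l IH] z fM.
  by rewrite expr0 mul1r; have := fM 0; rewrite scale0r addr0 normc0 mul0r; apply.
rewrite iterS.
set g := iter l (dird u) f.
have sC : s%:C != 0 by rewrite -normc_eq0 normc_real normr_eq0 gt_eqF.
have -> : dird u g z = (s%:C)^-1 * 'd g z (s%:C *: u).
  by rewrite diff_scale mulrA mulVf// mul1r.
rewrite normcM normcV normc_real gtr0_norm// exprS -[leRHS]mulrA ler_pdivrMl//.
have -> : s * (2 / s * ((2 / s) ^+ l * M)) = 2 * ((2 / s) ^+ l * M).
  by field; rewrite gt_eqF.
apply: Cauchy_estimate; first exact: differentiable_iter_dird.
move=> t t1; apply: IH => r rl; rewrite scalerA -addrA -scalerDl; apply: fM.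
apply: le_trans (le_normcD _ _) _; rewrite normcM t1 mul1r normc_real gtr0_norm//.
by rewrite mulrSr mulrDl mul1r addrC lerD2r.
Qed.

(** This makes the supremum in [weighted_sup] finite. Compactness enters through [box_induction] on
    the square that contains the disc. *)
Lemma disc_bounded f u z : (forall z, differentiable f z) -> exists M : R, 
  forall t : R[i], normc t <= 1 -> normc (f (z + t *: u)) <= M.
Proof.
move=> df.
pose P (x1 x2 y1 y2 : R) := exists M : R, forall x y, x1 <= x <= x2 -> y1 <= y <= y2 ->
  normc (f (z + (x +i* y) *: u)) <= M.
suff [M HM] : P (-1) 1 (-1) 1.
  exists M => -[x y] t1; apply: HM; rewrite -ler_norml; apply: le_trans t1.
    exact: (Re_le_normc (x +i* y)).
  exact: (Im_le_normc (x +i* y)).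
apply: (box_induction (P := P)); [lra|lra| |].
  move=> x y w h w0 h0 [M1 H1] [M2 H2] [M3 H3] [M4 H4].
  exists (Num.max (Num.max M1 M2) (Num.max M3 M4)) => a b /andP[xa ax] /andP[yb by_].
  rewrite !le_max; case: (lerP a (x + w)) => aw; case: (lerP b (y + h)) => bh.
  - by rewrite H1 ?xa ?yb.
  - by rewrite H2 ?xa ?(ltW bh) ?orbT.
  - by rewrite H3 ?(ltW aw) ?yb ?orbT.
  - by rewrite H4 ?(ltW aw) ?(ltW bh) ?orbT.
move=> x y; pose p := z + (x +i* y) *: u.
have [d d0 Hd] := continuous_approx (df p) (@ltr01 R).
have u1 : 0 < vnorm u + 1 by rewrite ltr_wpDl// vnorm_ge0.
exists (d / (vnorm u + 1) / 2); first by rewrite !divr_gt0.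
move=> x1 x2 y1 y2 /andP[x1x xx2] /andP[y1y yy2] dx dy.
exists (normc (f p) + 1) => a b /andP[x1a ax2] /andP[y1b by2].
have /Hd : vnorm (((a +i* b) - (x +i* y)) *: u) < d.
  rewrite vnormZ.
  have : normc ((a +i* b) - (x +i* y)) < d / (vnorm u + 1).
    apply: le_lt_trans (normc_le_ReIm _) _ => /=.
    have : `|a - x| <= x2 - x1 by rewrite ler_norml; apply/andP; split; lra.
    have : `|b - y| <= y2 - y1 by rewrite ler_norml; apply/andP; split; lra.
    by move: (`|a - x|) (`|b - y|) (d / _) dx dy => A B D; lra.
  rewrite ltr_pdivlMr//; apply: le_lt_trans.
  by rewrite ler_wpM2l ?normc_ge0// lerDl.
have -> : p + ((a +i* b) - (x +i* y)) *: u = z + (a +i* b) *: u.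
  by rewrite /p scalerBl addrA [X in X - _]addrAC addrK.
set q := z + (a +i* b) *: u => /ltW H.
have -> : f q = f p + (f q - f p) by rewrite [RHS]addrC subrK.
by apply: le_trans (le_normcD _ _) _; rewrite lerD2l.
Qed.

End growth.

(* The weight [(1 - |t|)^a] turns a Cauchy-type inequality with loss [r^-(2a)]
   into one without loss at an almost maximal point. *)
Lemma weighted_sup (R : realType) (g : R[i] -> R) (a : nat) (A C B : R) :
  (0 < a)%N -> 0 <= A -> 0 <= C -> (forall t, 0 <= g t) ->
  (forall t, normc t <= 1 -> g t <= B) ->
  (forall t r M, 0 < r -> normc t + r <= 1 ->
    (forall s, normc s <= r -> g (t + s) <= M) ->
    g t ^+ 3 <= A + C * r^-1 ^+ (2 * a) * M) ->
  exists N, [/\ 0 <= N, g 0 <= N & N ^+ 3 <= 8 * A + 8 ^+ a.+1 * C * N].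
Proof.
move=> a0 A0 C0 g0 gB gC.
pose S := [set (1 - normc t) ^+ a * g t | t in [set t : R[i] | normc t <= 1]]%classic.
have S0 : S (g 0).
  by exists 0; [rewrite /mkset normc0|rewrite normc0 subr0 expr1n mul1r].
have w1 (t : R[i]) : normc t <= 1 -> 0 <= 1 - normc t <= 1.
  by move=> t1; rewrite subr_ge0 t1 gerBl normc_ge0.
have Sub : ubound S B.
  move=> _ [t /= t1 <-]; apply: le_trans (gB t t1).
  by have /andP[? ?] := w1 t t1; rewrite ler_piMl// exprn_ile1.
have hS : has_sup S by split; [exists (g 0)|exists B].
have NS x : S x -> x <= sup S by move=> Sx; exact: sup_upper_bound.
have Nge0 : 0 <= sup S := le_trans (g0 0) (NS _ S0).
exists (sup S); split => //; first exact: NS.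
move: Nge0; rewrite le_eqVlt => /predU1P[<-|N0].
  by rewrite expr0n mulr0 addr0 mulr_ge0.
set N := sup S in N0 NS *.
have [_ [t /= t1 <-] Nt] : exists2 x, S x & N / 2 < x.
  have /(_ (N / 2)) := @sup_adherent _ S; rewrite divr_gt0// => /(_ isT hS)[x Sx Hx].
  by exists x => //; move: Hx; rewrite -/N; apply: le_lt_trans; lra.
set w := 1 - normc t in Nt.
have /andP[w0 w1'] := w1 t t1; rewrite -/w in w0 w1'.
have wp : 0 < w.
  rewrite lt_neqAle w0 andbT; apply/eqP => w00.
  move: Nt; rewrite -w00 expr0n -[a == 0%N]negbK -lt0n a0 /= mul0r => /(lt_trans _).
  by move=> /(_ 0 (divr_gt0 N0 (ltr0n _ 2))); rewrite ltxx.
(* On the disc of radius r around t the weight is still at least r^a, so g is at most N / r^a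
   there. *)
pose r := w / 2; have r0 : 0 < r by rewrite divr_gt0.
have := gC t r (N / r ^+ a) r0; rewrite {1}/r {1}/w => /(_ ltac:(lra)) H.
have {}H : g t ^+ 3 <= A + C * r^-1 ^+ (2 * a) * (N / r ^+ a).
  apply: H => s sr; rewrite ler_pdivlMr ?exprn_gt0// mulrC.
  have ts : normc (t + s) <= 1 - r.
    by apply: le_trans (le_normcD _ _) _; move: sr; rewrite /r /w; lra.
  apply: le_trans (NS ((1 - normc (t + s)) ^+ a * g (t + s)) _); last first.
    by exists (t + s) => //=; apply: le_trans ts _; rewrite gerBl ltW.
  rewrite ler_wpM2r// lerXn2r ?nnegrE ?(ltW r0)//; last by lra.
  by apply: le_trans (ltW r0) _; lra.
(* Multiplying by w^(3a) absorbs r^(-2a) r^(-a) exactly, leaving (w / r)^(3a) = 8^a; the last factor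
   8 is due to N / 2. *)
have H2 : (w ^+ a * g t) ^+ 3 <= A + 8 ^+ a * C * N.
  have w3 : 0 <= (w ^+ a) ^+ 3 <= 1 by rewrite !exprn_ge0// !exprn_ile1// exprn_ge0.
  have /andP[w30 w31] := w3.
  rewrite exprMn; apply: le_trans (ler_wpM2l w30 H) _; rewrite mulrDr; apply: lerD.
    by rewrite ler_piMl.
  have -> : (w ^+ a) ^+ 3 * (C * r^-1 ^+ (2 * a) * (N / r ^+ a)) = 8 ^+ a * C * N.
    have Ew : w ^+ a = 2 ^+ a * r ^+ a.
      by rewrite -exprMn; congr (_ ^+ a); rewrite /r; field.
    have E8 : 8 ^+ a = (2 ^+ a) ^+ 3 :> R.
      by rewrite -exprM mulnC exprM; congr (_ ^+ a); ring.
    have Er : r^-1 ^+ (2 * a) = ((r ^+ a) ^+ 2)^-1 by rewrite exprVn mulnC exprM.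
    by rewrite Ew E8 Er; field; rewrite expf_neq0// gt_eqF.
  by [].
have : (N / 2) ^+ 3 <= (w ^+ a * g t) ^+ 3.
  by rewrite lerXn2r ?nnegrE ?(ltW Nt)// ?mulr_ge0 ?exprn_ge0// ltW.
move=> /le_trans /(_ H2); rewrite expr_div_n ler_pdivrMr ?exprn_gt0//.
have -> : 2 ^+ 3 = 8 :> R by ring.
by move=> /le_trans; apply; rewrite le_eqVlt exprS; apply/orP; left; apply/eqP; ring.
Qed.

(** If N > k X with k = a + b + 1, then N^3 > k X^2 N, whereas the two terms on the right are at
    most a X^2 N and b X^2 N. *)
Lemma cube_bound (R : realFieldType) (N X a b : R) : 0 <= N -> 1 <= X ->
  0 <= a -> 0 <= b -> N ^+ 3 <= a * X ^+ 3 + b * N -> N <= (a + b + 1) * X.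
Proof.
move=> N0 X1 a0 b0 H; rewrite leNgt; apply/negP => kN.
have X0 : 0 < X := lt_le_trans ltr01 X1.
have k1 : 1 <= a + b + 1 by rewrite lerDr addr_ge0.
have XN : X < N by apply: le_lt_trans kN; rewrite ler_peMl// ltW.
have Np : 0 < N := lt_trans X0 XN.
have E1 : a * X ^+ 3 <= a * (X ^+ 2 * N).
  by rewrite ler_wpM2l// exprSr ler_wpM2l ?exprn_ge0 ?ltW.
have E2 : b * N <= b * (X ^+ 2 * N).
  by apply: ler_wpM2l => //; apply: ler_peMl => //; exact: exprn_ege1.
have E3 : (a + b + 1) * (X ^+ 2 * N) < N ^+ 3.
  rewrite [N ^+ 3]exprSr mulrA ltr_pM2r//.
  have kp : 0 <= a + b + 1 := le_trans ler01 k1.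
  apply: (@le_lt_trans _ _ (((a + b + 1) * X) ^+ 2)).
    by rewrite exprMn ler_wpM2r ?exprn_ge0 ?(ltW X0)// expr2 ler_peMl.
  by rewrite ltrXn2r ?nnegrE ?mulr_ge0// ltW.
have : 0 < X ^+ 2 * N by rewrite mulr_gt0 ?exprn_gt0.
lra.
Qed.

Lemma solution_growth (R : realType) (V : normedModType R[i]) (f : V -> R[i]^o)
    (u : V) (W : V -> R[i]) (kappa p1 p2 : R[i]) (a : nat) :
  (forall z, differentiable f z) -> (0 < a)%N ->
  (forall z t, W (z + t *: u) = W z + t * kappa) ->
  (forall z, f z ^+ 3 + iter (2 * a) (dird u) f z =
     p1 * cexp (W z) + p2 * cexp (- W z)) ->
  exists2 K : R, 0 <= K & forall z,
    normc (f z) <= K * expR (`|Re (W z)| / 3) /\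
    normc (iter (2 * a) (dird u) f z) <= K * expR (`|Re (W z)| / 3).
Proof.
move=> df a0 WD eqf.
set l := (2 * a)%N in eqf *.
have l0 : (0 < l)%N by rewrite muln_gt0.
have lR : 0 < l%:R :> R by rewrite ltr0n.
pose P := normc p1 + normc p2.
have P0 : 0 <= P by rewrite addr_ge0 ?normc_ge0.
pose X z := expR (`|Re (W z)| / 3).
have X1 z : 1 <= X z by rewrite -expR0 ler_expR divr_ge0.
have X3 z : X z ^+ 3 = expR `|Re (W z)|.
  by rewrite -expRM_natl; congr expR; field.
pose k := normc kappa.
(* On the unit disc in direction u the size X changes at most by the factor e^(k/3), which does not
   depend on z; this makes K uniform. *)
have ReW z t : normc t <= 1 -> `|Re (W (z + t *: u))| <= `|Re (W z)| + k.
  move=> t1; rewrite WD ReD; apply: le_trans (ler_normD _ _) _; rewrite lerD2l.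
  by apply: le_trans (Re_le_normc _) _; rewrite normcM ler_piMl ?normc_ge0.
have rhs w : normc (p1 * cexp w + p2 * cexp (- w)) <= P * expR `|Re w|.
  apply: le_trans (le_normcD _ _) _; rewrite !normcM !normc_cexp mulrDl ReN.
  apply: lerD; rewrite ler_wpM2l ?normc_ge0// ler_expR ?ler_norm//.
  by rewrite -normrN ler_norm.
(* From (2 / (r / l))^l = (2 l)^l r^(-l): l Cauchy estimates of radius r / l. *)
pose C := (2 * l%:R) ^+ l : R.
have C0 : 0 <= C by rewrite exprn_ge0// mulr_ge0.
pose K1 := 8 * (P * expR k) + 8 ^+ a.+1 * C + 1.
have K10 : 0 <= K1.
  by rewrite !addr_ge0// mulr_ge0 ?exprn_ge0// mulr_ge0// expR_ge0.
have fK z : normc (f z) <= K1 * X z.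
  have [B HB] := disc_bounded u z df.
  have [||N [N0 fN HN]] := @weighted_sup R (fun t => normc (f (z + t *: u))) a
      (P * (expR k * X z ^+ 3)) C B a0 _ C0 (fun t => normc_ge0 _) HB.
  - by rewrite mulr_ge0// mulr_ge0 ?expR_ge0// exprn_ge0// (le_trans ler01).
  - move=> t r M r0 tr fM; have t1 : normc t <= 1 by lra.
    rewrite -normcX.
    have -> : f (z + t *: u) ^+ 3 =
      (p1 * cexp (W (z + t *: u)) + p2 * cexp (- W (z + t *: u))) -
      iter l (dird u) f (z + t *: u) by rewrite -eqf addrK.
    apply: le_trans (normcB_le _ _) _; apply: lerD.
      apply: le_trans (rhs _) _; rewrite ler_wpM2l// X3 -expRD ler_expR [leRHS]addrC.
      exact: ReW.
    have sp : 0 < r / l%:R by rewrite divr_gt0.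
    have := @iter_dird_bound R V f u (r / l%:R) M l (z + t *: u) df sp.
    have -> : l%:R * (r / l%:R) = r by field; rewrite pnatr_eq0 -lt0n.
    have -> : 2 / (r / l%:R) = (2 * l%:R) * r^-1.
      by field; rewrite pnatr_eq0 -lt0n l0 gt_eqF.
    rewrite exprMn; apply => s sr; rewrite -addrA -scalerDl; exact: fM.
  - rewrite scale0r addr0 in fN; apply: le_trans fN _.
    apply: cube_bound => //.
    + by rewrite mulr_ge0// mulr_ge0// expR_ge0.
    + by rewrite mulr_ge0// exprn_ge0.
    + by rewrite -!mulrA; rewrite -mulrA in HN.
pose K2 := C * (K1 * expR (k / 3)).
have K20 : 0 <= K2 by rewrite !mulr_ge0// expR_ge0.
have X0 z : 0 <= X z by exact: expR_ge0.
exists (K1 + K2); first exact: addr_ge0.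
move=> z; rewrite -/(X z) mulrDl; split.
  by apply: le_trans (fK z) _; rewrite lerDl mulr_ge0.
apply: (@le_trans _ _ (K2 * X z)); last by rewrite lerDr mulr_ge0.
have sp : 0 < l%:R^-1 :> R by rewrite invr_gt0.
have := @iter_dird_bound R V f u (l%:R^-1) (K1 * (expR (k / 3) * X z)) l z df sp.
rewrite invrK mulfV ?gt_eqF// => H.
rewrite /K2 -!mulrA; apply: H => t t1; apply: le_trans (fK _) _.
rewrite ler_wpM2l// /X -expRD ler_expR -mulrDl ler_pM2r ?invr_gt0// [leRHS]addrC.
exact: ReW.
Qed.

(** * Asymptotics in half-spaces *)

Lemma ler_dist_normc (R : rcfType) (x y : R[i]) :
  `|normc x - normc y| <= normc (x - y).
Proof.
rewrite ler_norml lerB_normc andbT lerNl opprB normcB_sym; exact: lerB_normc.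
Qed.

(** |x^3 - q| is the product of the distances from x to the three cube roots of q, hence at least
    the cube of the smallest one. The primitive cube root of unity is w = (sqrt(-3) - 1) / 2. *)
Lemma near_cube_root (R : realType) (x q : R[i]) :
  exists2 c : R[i], c ^+ 3 = q & normc (x - c) ^+ 3 <= normc (x ^+ 3 - q).
Proof.
pose c0 : R[i] := 3.-root q.
have c03 : c0 ^+ 3 = q by rewrite rootCK.
pose s : R[i] := sqrtC (- 3).
have s2 : s ^+ 2 = - 3 by rewrite sqrtCK.
pose w := (s - 1) / 2.
have w2 : w ^+ 2 = - w - 1.
  have -> : w ^+ 2 = (s ^+ 2 - 2 * s + 1) / 4 by rewrite /w; field.
  by rewrite s2 /w; field.
have w3 : w ^+ 3 = 1 by rewrite exprS w2 mulrBr mulrN -expr2 w2; ring.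
have fact : x ^+ 3 - q = (x - c0) * ((x - w * c0) * (x - w ^+ 2 * c0)).
  rewrite w2 -c03.
  have -> : (x - c0) * ((x - w * c0) * (x - (- w - 1) * c0)) =
    x ^+ 3 - c0 ^+ 3 + (w ^+ 2 + w + 1) * (c0 ^+ 3 - x * c0 ^+ 2) by ring.
  by rewrite w2; ring.
rewrite fact !normcM.
set A := normc (x - c0); set B := normc (x - w * c0); set C := normc (x - w ^+ 2 * c0).
have A0 : 0 <= A := normc_ge0 _; have B0 : 0 <= B := normc_ge0 _.
have C0 : 0 <= C := normc_ge0 _.
have cube (y : R) : 0 <= y -> y <= A -> y <= B -> y <= C -> y ^+ 3 <= A * (B * C).
  by move=> y0 yA yB yC; rewrite !exprS expr0 mulr1 ler_pM ?mulr_ge0// ler_pM.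
have [AB|BA] := leP A B; have [AC|CA] := leP A C.
- by exists c0 => //; exact: cube.
- exists (w ^+ 2 * c0); last by apply: cube => //; [exact: ltW|exact: le_trans (ltW CA) AB].
  by rewrite exprMn -exprM mulnC exprM w3 expr1n mul1r.
- exists (w * c0); last by apply: cube => //; [exact: ltW|exact: le_trans (ltW BA) AC].
  by rewrite exprMn w3 mul1r.
- have [BC|CB] := leP B C.
    exists (w * c0); last by apply: cube => //; exact: ltW.
    by rewrite exprMn w3 mul1r.
  exists (w ^+ 2 * c0); last by apply: cube => //; exact: ltW.
  by rewrite exprMn -exprM mulnC exprM w3 expr1n mul1r.
Qed.

(* If [h^3] stays close to [q] then [|h - c|] cannot take the value [|c|/4], so by
   the intermediate value theorem [h] stays close to a single cube root [c]. *)
Lemma cube_root_selection (R : realType) (V : normedModType R[i]) (D : V -> Prop)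
    (h : V -> R[i]^o) (q : R[i]) (rho : R) (z0 : V) :
  0 < rho -> normc q = rho ^+ 3 -> D z0 ->
  (forall z z' (s : R), D z -> D z' -> 0 <= s <= 1 -> D (z + s%:C *: (z' - z))) ->
  (forall z, differentiable h z) ->
  (forall z, D z -> normc (h z ^+ 3 - q) < (rho / 4) ^+ 3) ->
  exists2 c, c ^+ 3 = q & forall z, D z -> normc (h z - c) * rho ^+ 2 <= normc (h z ^+ 3 - q).
Proof.
move=> rho0 nq D0 Dconv dh hq.
have [c c3 hc] := near_cube_root (h z0) q.
have nc : normc c = rho.
  apply/eqP; rewrite -(@eqrXn2 _ 3) ?normc_ge0 ?ltW//.
  by rewrite -normcX c3 nq.
(* The cofactor 3 c^2 + 3 c (x - c) + (x - c)^2 has modulus at least (3 - 3/2 - 1/4) rho^2 >=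
   rho^2. *)
have key x : normc (x - c) <= rho / 2 -> normc (x - c) * rho ^+ 2 <= normc (x ^+ 3 - q).
  move=> xc; have -> : x ^+ 3 - q =
      (x - c) * (3 * c ^+ 2 - (- (3 * c * (x - c)) - (x - c) ^+ 2)).
    by rewrite -c3; ring.
  rewrite normcM ler_wpM2l ?normc_ge0//.
  apply: le_trans (lerB_normc _ _).
  have n3 : normc (3 : R[i]) = 3.
    by rewrite -[3 in LHS](rmorph_nat (real_complex R)) normc_real normr_nat.
  have := normcB_le (- (3 * c * (x - c))) ((x - c) ^+ 2).
  rewrite normcN [normc (_ ^+ 2)]normcX [normc (3 * c * _)]normcM [normc (3 * c)]normcM n3 nc => H.
  have -> : normc (3 * c ^+ 2) = 3 * rho ^+ 2 by rewrite normcM normcX n3 nc.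
  have n0 := normc_ge0 (x - c).
  have : normc (x - c) ^+ 2 <= (rho / 2) ^+ 2 by rewrite lerXn2r ?nnegrE// divr_ge0// ltW.
  have : 3 * rho * normc (x - c) <= 3 * rho * (rho / 2) by rewrite ler_wpM2l// mulr_ge0// ltW.
  have r2 : 0 <= rho ^+ 2 by exact: sqr_ge0.
  have -> : 3 * rho * (rho / 2) = 3 / 2 * rho ^+ 2 by field.
  have -> : (rho / 2) ^+ 2 = rho ^+ 2 / 4 by field.
  by move=> H1 H2; lra.
have c4 : normc (h z0 - c) < rho / 4.
  have := le_lt_trans hc (hq _ D0).
  by rewrite ltr_pXn2r ?nnegrE ?normc_ge0 ?divr_ge0 ?(ltW rho0).
exists c => // z Dz; apply: (key); apply: le_trans (_ : rho / 4 <= _); last by lra.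
rewrite leNgt; apply/negP => zc.
pose phi (s : R) := normc (h (z0 + s%:C *: (z - z0)) - c).
have cphi : continuous phi.
  move=> s; apply/(@cvgrPdist_lt _ _ _ (nbhs s)) => e e0.
  have [d d0 Hd] := continuous_approx (dh (z0 + s%:C *: (z - z0))) e0.
  have v1 : 0 < vnorm (z - z0) + 1 by rewrite ltr_wpDl// vnorm_ge0.
  apply/nbhs_normP; exists (d / (vnorm (z - z0) + 1)); first by rewrite /= divr_gt0.
  move=> t /= st.
  have := Hd ((t - s)%:C *: (z - z0)).
  rewrite vnormZ normc_real distrC -addrA -scalerDl -rmorphD subrKC => H.
  have {}H : normc (h (z0 + t%:C *: (z - z0)) - h (z0 + s%:C *: (z - z0))) < e.
    apply: H; rewrite ltr_pdivlMr// in st; apply: le_lt_trans st.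
    by rewrite ler_wpM2l// lerDl.
  apply: le_lt_trans H; apply: le_trans (ler_dist_normc _ _) _.
  by rewrite normcB_sym opprB addrA subrK.
have [|s] := @IVT R phi 0 1 (rho / 4) ler01 (continuous_subspaceT cphi).
  rewrite /phi scale0r addr0 scale1r subrKC ge_min le_max.
  by rewrite (ltW c4) (ltW zc) orbT.
rewrite in_itv /= => s01 phis.
have := hq _ (Dconv _ _ _ D0 Dz s01).
(* At distance rho/4 from c, [key] gives |x^3 - q| >= rho^3 / 4, whereas [hq] asks for less than
   rho^3 / 64. *)
rewrite ltNge => /negP; apply; apply: le_trans (key _ _); rewrite -/(phi s) phis; last by lra.
have -> : (rho / 4) ^+ 3 = rho / 4 * rho ^+ 2 / 16 by field.
by rewrite ler_pdivrMr// ler_peMr ?mulr_ge0 ?divr_ge0 ?sqr_ge0 ?ltW//; lra.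
Qed.

(** * Classification *)

Section exponential_form.
Variables (R : realType) (V : normedModType R[i]) (W : {linear V -> R[i]^o}).
Hypothesis cW : continuous W.

Definition lexp (a : R[i]) (z : V) : R[i]^o := cexp (a * W z).

Lemma is_diff_lexp a z : differentiable (lexp a) z /\
  forall h, 'd (lexp a) z h = a * W h * lexp a z.
Proof.
pose L : {linear V -> R[i]^o} := a \*: W.
have cL : continuous L.
  by move=> w; apply: continuousM; [exact: cvg_cst|exact: cW].
have dL w : differentiable L w by exact: linear_differentiable.
have [dc dcE] := is_diff_cexp (L z).
have E : lexp a = (@cexp R : R[i]^o -> R[i]^o) \o L by [].
rewrite E; split; first exact: differentiable_comp.
move=> h; rewrite (diff_comp (dL z) dc) /= dcE (diff_lin _ cL) mulrC.
by rewrite /lexp.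
Qed.

Lemma differentiable_lexp a z : differentiable (lexp a) z.
Proof. by case: (is_diff_lexp a z). Qed.

Lemma derive_lexp a z u : 'D_u (lexp a) z = a * W u * lexp a z.
Proof. exact: etrans (deriveE u (differentiable_lexp a z)) ((is_diff_lexp a z).2 u). Qed.

Lemma differentiable_lexp2 (c d a b : R[i]) z :
  differentiable (fun w => c * lexp a w + d * lexp b w : R[i]^o) z.
Proof.
exact: (differentiableD (differentiableZ c (differentiable_lexp a z))
  (differentiableZ d (differentiable_lexp b z))).
Qed.

Lemma dird_lexp2 (c d a b : R[i]) u : dird u (fun w => c * lexp a w + d * lexp b w) =
  (fun w => c * (a * W u) * lexp a w + d * (b * W u) * lexp b w).
Proof.
apply/funext => z; rewrite /dird.
have da := differentiable_lexp a z; have db := differentiable_lexp b z.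
have va := diff_derivable (v := u) da; have vb := diff_derivable (v := u) db.
apply: (etrans (esym (deriveE u (differentiable_lexp2 c d a b z)))).
have D := deriveD (derivableZ (k := c) va) (derivableZ (k := d) vb).
set F := (X in 'D_u X z) in D.
rewrite (_ : (fun w => _) = F); last by [].
rewrite D.
rewrite (deriveZ c va) (deriveZ d vb).
rewrite (derive_lexp a) (derive_lexp b).
by congr (_ + _); rewrite -[LHS]/(_ * (_ * _)) mulrA.
Qed.

Lemma iter_dird_lexp2 (c d a b : R[i]) u l :
  iter l (dird u) (fun w => c * lexp a w + d * lexp b w) =
  (fun w => c * (a * W u) ^+ l * lexp a w + d * (b * W u) ^+ l * lexp b w).
Proof.
elim: l => [|l IH]; first by rewrite /= !expr0 !mulr1.
by rewrite iterS IH dird_lexp2; apply/funext => w; rewrite !exprSr !mulrA.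
Qed.

End exponential_form.

(** The Cauchy estimate on discs of arbitrarily large radius kills the differential, and
    [mean_value_bound] with c = 0 concludes. *)
Theorem Liouville (R : realType) (V : normedModType R[i]) (G : V -> R[i]^o) (B : R) :
  (forall z, differentiable G z) -> (forall z, normc (G z) <= B) ->
  forall z, G z = G 0.
Proof.
move=> dG GB.
have dG0 z v : 'd G z v = 0.
  apply: eq0_normc; apply/eqP; rewrite eq_le normc_ge0 andbT.
  apply/ler_addgt0Pl => e e0; rewrite addr0.
  have B0 : 0 <= B := le_trans (normc_ge0 _) (GB 0).
  pose a : R := (2 * B + 1) / e.
  have a0 : 0 < a by rewrite divr_gt0// ltr_wpDl// mulr_ge0.
  have : normc ('d G z (a%:C *: v)) <= 2 * B.
    by apply: Cauchy_estimate => // t _; exact: GB.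
  rewrite diff_scale normcM normc_real gtr0_norm// => H.
  rewrite -(ler_pM2l a0); apply: le_trans H _.
  by rewrite divfK ?gt_eqF// lerDl.
move=> z; apply/eqP; rewrite -subr_eq0 -normc_eq0 eq_le normc_ge0 andbT.
have := @mean_value_bound R V G 0 z 0 0 dG.
by rewrite add0r subr0 mulr0; apply => s _; rewrite dG0 subr0 normc0.
Qed.

Section classification.
Variables (R : realType) (V : normedModType R[i]) (W : {linear V -> R[i]^o}).
Hypotheses (cW : continuous W) (v1 : V) (Wv1 : W v1 = 1).
Implicit Types (f g : V -> R[i]^o).

Lemma linear_form_onto (w : R[i]) : W (w *: v1) = w.
Proof. by rewrite linearZ /= Wv1 /GRing.scale /= mulr1. Qed.

(** Here g stands for D^l f; keeping g and W abstract lets the other half-space be the same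
    statement for -W with p1 and p2 exchanged. For h = f e^(-W/3) one has h^3 - p1 = (p2 e^(-W) - g)
    e^(-W) = O(e^(-2x/3)) with x = Re W, and multiplying back by e^(x/3) leaves e^(-x/3). *)
Lemma half_space_asymptotics f g (p1 p2 : R[i]) (K : R) : p1 != 0 ->
  (forall z, differentiable f z) ->
  (forall z, f z ^+ 3 + g z = p1 * cexp (W z) + p2 * cexp (- W z)) ->
  (forall z, normc (g z) <= K * expR (`|Re (W z)| / 3)) ->
  exists2 c, c ^+ 3 = p1 & exists X0 B : R, [/\ 0 <= X0, 0 <= B &
    forall z, X0 <= Re (W z) ->
      normc (f z - c * lexp W (3^-1) z) <= B * expR (- (Re (W z) / 3))].
Proof.
move=> p10 df eqf gK.
have K0 : 0 <= K.
  have := le_trans (normc_ge0 _) (gK 0).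
  by rewrite pmulr_lge0// expR_gt0.
pose M := normc p2 + K.
have M0 : 0 <= M by rewrite addr_ge0 ?normc_ge0.
pose c0 : R[i] := 3.-root p1; pose rho := normc c0.
have nq : normc p1 = rho ^+ 3 by rewrite -normcX rootCK.
have rho0 : 0 < rho by rewrite normc_gt0 rootC_eq0.
pose h z : R[i]^o := f z * lexp W (- 3^-1) z.
have dh z : differentiable h z.
  exact: differentiableM (df z) (differentiable_lexp cW _ z).
have h3 z : h z ^+ 3 - p1 = (p2 * cexp (- W z) - g z) * cexp (- W z).
  have -> : h z ^+ 3 = f z ^+ 3 * cexp (- W z).
    rewrite exprMn /lexp -cexp_mulrn; congr (_ * cexp _).
    by rewrite -mulr_natr; field.
  have -> : f z ^+ 3 = p1 * cexp (W z) + p2 * cexp (- W z) - g z.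
    by rewrite -eqf addrK.
  have E := cexpNK (W z).
  rewrite (_ : p1 = p1 * (cexp (- W z) * cexp (W z))); last by rewrite E mulr1.
  by ring: E.
pose y := M / (rho / 4) ^+ 3.
have y0 : 0 <= y by rewrite divr_ge0// exprn_ge0// divr_ge0// ltW.
(* Chosen so that x >= X0 gives e^(2x/3) >= 1 + 2x/3 >= 1 + y > y, which is the smallness required
   by [cube_root_selection]. *)
pose X0 := 3 / 2 * y.
have X00 : 0 <= X0 by rewrite mulr_ge0// divr_ge0.
pose D z := X0 <= Re (W z).
have hM z : D z -> normc (h z ^+ 3 - p1) <= M * expR (- (2 / 3 * Re (W z))).
  move=> Dz; have x0 : 0 <= Re (W z) := le_trans X00 Dz.
  rewrite h3 normcM normc_cexp ReN.
  apply: (@le_trans _ _ ((normc p2 + K * expR (Re (W z) / 3)) * expR (- Re (W z)))).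
    rewrite ler_wpM2r ?expR_ge0//; apply: le_trans (normcB_le _ _) _; apply: lerD.
      rewrite normcM normc_cexp ReN ler_piMr ?normc_ge0// -expR0 ler_expR.
      by rewrite oppr_le0.
    by have := gK z; rewrite ger0_norm.
  rewrite !mulrDl; apply: lerD.
    by rewrite ler_wpM2l ?normc_ge0// ler_expR; lra.
  by rewrite -[leLHS]mulrA ler_wpM2l// -expRD ler_expR; lra.
have hq z : D z -> normc (h z ^+ 3 - p1) < (rho / 4) ^+ 3.
  move=> Dz; apply: le_lt_trans (hM z Dz) _.
  have r4 : 0 < (rho / 4) ^+ 3 by rewrite exprn_gt0// divr_gt0.
  rewrite expRN ltr_pdivrMr ?expR_gt0// mulrC -ltr_pdivrMr// -/y.
  apply: lt_le_trans (_ : 1 + y <= _); first by rewrite ltrDr.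
  apply: le_trans (expR_ge1Dx _) _; rewrite ler_expR.
  by move: Dz; rewrite /D /X0; lra.
have D0 : D (X0%:C *: v1) by rewrite /D linear_form_onto.
have Dconv z z' (s : R) : D z -> D z' -> 0 <= s <= 1 -> D (z + s%:C *: (z' - z)).
  move=> Dz Dz' /andP[s0 s1]; rewrite /D linearD linearZ linearB /=.
  rewrite ReD /GRing.scale /= ReM /= mul0r subr0 ReB.
  have : 0 <= (1 - s) * (Re (W z) - X0) + s * (Re (W z') - X0).
    by rewrite addr_ge0// mulr_ge0 ?subr_ge0.
  by lra.
have [c c3 hc] := cube_root_selection rho0 nq D0 Dconv dh hq.
exists c => //; exists X0, (M / rho ^+ 2); split => //.
  by rewrite divr_ge0// sqr_ge0.
move=> z Dz.
have -> : f z - c * lexp W 3^-1 z = (h z - c) * lexp W 3^-1 z.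
  rewrite mulrBl /h -mulrA /lexp -cexpD mulNr addNr cexp0 mulr1//.
rewrite normcM /lexp normc_cexp.
have -> : Re (3^-1 * W z) = Re (W z) / 3.
  rewrite (_ : (3^-1 : R[i]) = (3^-1)%:C) ?ReM /= ?mul0r ?subr0 1?mulrC//.
  by rewrite fmorphV rmorph_nat.
have r2 : 0 < rho ^+ 2 by rewrite exprn_gt0.
have := le_trans (hc z Dz) (hM z Dz); rewrite -ler_pdivlMr// => H.
apply: le_trans (ler_wpM2r (expR_ge0 _) H) _.
rewrite [leLHS](_ : _ = M / rho ^+ 2 * (expR (- (2 / 3 * Re (W z))) * expR (Re (W z) / 3))).
  by rewrite -expRD ler_wpM2l ?ler_expR; [lra|rewrite divr_ge0// ltW|lra].
by ring.
Qed.

Lemma normc_lexp3 z : normc (lexp W 3^-1 z) = expR (Re (W z) / 3).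
Proof.
rewrite /lexp normc_cexp (_ : (3^-1 : R[i]) = (3^-1)%:C) ?fmorphV ?rmorph_nat//.
by rewrite -(rmorph_nat (real_complex R)) -fmorphV ReM /= mul0r subr0 mulrC.
Qed.

Lemma lexpNK a z : lexp W (- a) z * lexp W a z = 1.
Proof. by rewrite /lexp mulNr cexpNK. Qed.

Lemma normc_lexpN3 z : normc (lexp W (- 3^-1) z) = expR (- (Re (W z) / 3)).
Proof. by rewrite /lexp mulNr cexpN normcV -/(lexp W _ z) normc_lexp3 expRN. Qed.

Lemma lexp3_cube z : lexp W 3^-1 z ^+ 3 = cexp (W z).
Proof. by rewrite /lexp -cexp_mulrn; congr cexp; rewrite -mulr_natr; field. Qed.

Lemma lexpN3_cube z : lexp W (- 3^-1) z ^+ 3 = cexp (- W z).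
Proof. by rewrite /lexp -cexp_mulrn; congr cexp; rewrite -mulr_natr; field. Qed.

End classification.

Lemma classification (R : realType) (V : normedModType R[i])
    (W : {linear V -> R[i]^o}) (v1 u : V) (f : V -> R[i]^o) (p1 p2 : R[i]) (a : nat) :
  continuous W -> W v1 = 1 -> p1 != 0 -> p2 != 0 -> (0 < a)%N ->
  (forall z, differentiable f z) ->
  (forall z, f z ^+ 3 + iter (2 * a) (dird u) f z =
    p1 * cexp (W z) + p2 * cexp (- W z)) ->
  exists c d, [/\ c ^+ 3 = p1, d ^+ 3 = p2 &
    forall z, f z = c * lexp W 3^-1 z + d * lexp W (- 3^-1) z].
Proof.
move=> cW Wv1 p10 p20 a0 df eqf.
have WD z t : W (z + t *: u) = W z + t * W u by rewrite linearD linearZ.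
have [K K0 HK] := solution_growth df a0 WD eqf.
have [c c3 [X1 [B1 [X10 B10 H1]]]] :=
  half_space_asymptotics cW Wv1 p10 df eqf (fun z => (HK z).2).
pose W' : {linear V -> R[i]^o} := (-1) \*: W.
have W'E z : W' z = - W z by rewrite -[LHS]/(-1 * W z) mulN1r.
have cW' : continuous W'.
  by move=> w; apply: continuousM; [exact: cvg_cst|exact: cW].
have W'v : W' (- v1) = 1 by rewrite W'E linearN opprK.
have [|z|d d3 [X2 [B2 [X20 B20 H2]]]] :=
  half_space_asymptotics (g := iter (2 * a) (dird u) f) (p1 := p2)
    (p2 := p1) (K := K) cW' W'v p20 df.
- by move=> z; rewrite W'E opprK eqf addrC.
- by rewrite W'E ReN normrN; exact: (HK z).2.
exists c, d; split => //.
pose G z : R[i]^o := f z - (c * lexp W 3^-1 z + d * lexp W (- 3^-1) z).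
have dG z : differentiable G z.
  exact: differentiableB (df z) (differentiable_lexp2 cW c d _ _ z).
have GR z : X1 <= Re (W z) -> normc (G z) <= (B1 + normc d) * expR (- (Re (W z) / 3)).
  move=> xz; rewrite /G opprD addrA mulrDl.
  apply: le_trans (normcB_le _ _) _; apply: lerD; first exact: H1.
  by rewrite normcM normc_lexpN3.
have GL z : Re (W z) <= - X2 -> normc (G z) <= (B2 + normc c) * expR (Re (W z) / 3).
  move=> xz; rewrite /G [c * _ + _]addrC opprD addrA mulrDl.
  apply: le_trans (normcB_le _ _) _; apply: lerD.
    have -> : lexp W (- 3^-1) z = lexp W' 3^-1 z by rewrite /lexp W'E mulrN mulNr.
    have := H2 z; rewrite W'E ReN mulNr opprK; apply; lra.
  by rewrite normcM normc_lexp3.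
have GM z Y : `|Re (W z)| <= Y -> normc (G z) <= (K + normc c + normc d) * expR (Y / 3).
  move=> xY; have ex (x : R) : x <= Y -> expR (x / 3) <= expR (Y / 3).
    by move=> xy; rewrite ler_expR; lra.
  rewrite /G opprD addrA !mulrDl.
  apply: le_trans (normcB_le _ _) _; apply: lerD; last first.
    rewrite normcM normc_lexpN3 -mulNr ler_wpM2l ?normc_ge0// ex//.
    by apply: le_trans xY; rewrite -normrN ler_norm.
  apply: le_trans (normcB_le _ _) _; apply: lerD; last first.
    rewrite normcM normc_lexp3 ler_wpM2l ?normc_ge0// ex//.
    by apply: le_trans xY; rewrite ler_norm.
  by apply: le_trans (HK z).1 _; rewrite ler_wpM2l// ex.
have c0 := normc_ge0 c; have d0 := normc_ge0 d.
(* Three regions: the two half-spaces, where the asymptotics apply, and the strip -X2 < Re W < X1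
   between them, where the growth bound is enough. *)
have GB z : normc (G z) <= (B1 + normc d) + (B2 + normc c) +
    (K + normc c + normc d) * expR ((X1 + X2) / 3).
  have P0 : 0 <= (K + normc c + normc d) * expR ((X1 + X2) / 3).
    by rewrite mulr_ge0 ?expR_ge0// !addr_ge0.
  have [xz|xz] := leP X1 (Re (W z)).
    apply: le_trans (GR z xz) _.
    have e1 : expR (- (Re (W z) / 3)) <= 1.
      by rewrite -expR0 ler_expR oppr_le0 divr_ge0// (le_trans X10).
    have : (B1 + normc d) * expR (- (Re (W z) / 3)) <= B1 + normc d.
      by rewrite ler_piMr// addr_ge0.
    by lra.
  have [xz2|xz2] := leP (Re (W z)) (- X2).
    apply: le_trans (GL z xz2) _.
    have e1 : expR (Re (W z) / 3) <= 1.
      by rewrite -expR0 ler_expR pmulr_lle0 ?invr_gt0// (le_trans xz2)// oppr_le0.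
    have : (B2 + normc c) * expR (Re (W z) / 3) <= B2 + normc c.
      by rewrite ler_piMr// addr_ge0.
    by lra.
  have xY : `|Re (W z)| <= X1 + X2 by rewrite ler_norml; apply/andP; split; lra.
  by have := GM z _ xY; lra.
have Gc := Liouville dG GB.
suff G0 : G 0 = 0.
  by move=> z; apply/eqP; rewrite -subr_eq0; apply/eqP; rewrite -[LHS]/(G z) Gc.
apply: eq0_normc; apply/eqP; rewrite eq_le normc_ge0 andbT leNgt; apply/negP => n0.
set n := normc (G 0) in n0.
pose y := (B1 + normc d) / n.
have y0 : 0 <= y by rewrite divr_ge0 ?addr_ge0// ltW.
(* Then e^(x/3) >= 1 + x/3 > y, so the decay of [GR] at x v1 contradicts the constant value n > 0 of
   |G|. *)
pose x := X1 + 3 * y.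
have xE : Re (W (x%:C *: v1)) = x by rewrite (linear_form_onto Wv1).
have := GR (x%:C *: v1); rewrite Gc xE -/n => /(_ _) Hn.
have {}Hn : n <= (B1 + normc d) * expR (- (x / 3)) by apply: Hn; rewrite /x; lra.
move: Hn; rewrite expRN ler_pdivlMr ?expR_gt0//; apply/negP; rewrite -ltNge.
rewrite mulrC -ltr_pdivrMr// -/y; apply: lt_le_trans (_ : 1 + x / 3 <= _).
  by rewrite /x; lra.
exact: expR_ge1Dx.
Qed.

(** * Which exponential sums solve the equation, and their transcendence *)

Lemma cexp_pihalf (R : realType) : cexp (0 +i* (pi / 2)) = 'i%C :> R[i].
Proof. by rewrite /cexp /= expR0 cos_pihalf sin_pihalf mulr0 mulr1. Qed.

Lemma cexpN_pihalf (R : realType) : cexp (- (0 +i* (pi / 2))) = - 'i%C :> R[i].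
Proof.
by rewrite /cexp /= oppr0 expR0 cosN sinN cos_pihalf sin_pihalf mulr0 mul1r; simpc.
Qed.

(** Independence of e^w and e^(-w), tested at w = 0 and w = i pi/2: c + d = 0 and i (c - d) = 0. *)
Lemma exp_combination_eq0 (R : realType) (c d : R[i]) : c + d = 0 ->
  c * cexp (0 +i* (pi / 2)) + d * cexp (- (0 +i* (pi / 2))) = 0 -> c = 0.
Proof.
rewrite cexp_pihalf cexpN_pihalf => E0.
have -> : d = - c by apply/eqP; rewrite -addr_eq0 addrC E0.
rewrite mulrNN -mulr2n => /eqP; rewrite mulrn_eq0 /= mulf_eq0 => /orP[/eqP //|].
by rewrite eq_complex /= oner_eq0 andbF.
Qed.

(** For f = c e^(W/3) + d e^(-W/3) the mixed terms of f^3 are 3 c d f, and D^l f = (W u / 3)^l f by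
    parity. Hence the equation fails exactly by a constant multiple of f, and f is not identically 0
    because c is not 0. *)
Lemma pde_lexp2P (R : realType) (V : normedModType R[i])
    (W : {linear V -> R[i]^o}) (v1 u : V) (c d : R[i]) (a : nat) :
  continuous W -> W v1 = 1 -> c != 0 ->
  (forall z, (c * lexp W 3^-1 z + d * lexp W (- 3^-1) z) ^+ 3 +
     iter (2 * a) (dird u) (fun z => c * lexp W 3^-1 z + d * lexp W (- 3^-1) z) z =
     c ^+ 3 * cexp (W z) + d ^+ 3 * cexp (- W z)) <->
  3 * c * d + (W u / 3) ^+ (2 * a) = 0.
Proof.
move=> cW Wv1 c0.
have key z : (c * lexp W 3^-1 z + d * lexp W (- 3^-1) z) ^+ 3 +
    iter (2 * a) (dird u) (fun z => c * lexp W 3^-1 z + d * lexp W (- 3^-1) z) z =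
    c ^+ 3 * cexp (W z) + d ^+ 3 * cexp (- W z) +
    (3 * c * d + (W u / 3) ^+ (2 * a)) * (c * lexp W 3^-1 z + d * lexp W (- 3^-1) z).
  rewrite iter_dird_lexp2// mulNr !exprM sqrrN -!exprM [3^-1 * W u]mulrC.
  rewrite -(lexp3_cube W) -(lexpN3_cube W).
  by have E := lexpNK W 3^-1 z; ring: E.
split => [H|H z]; last by rewrite key H mul0r addr0.
have {}H z : (3 * c * d + (W u / 3) ^+ (2 * a)) *
    (c * lexp W 3^-1 z + d * lexp W (- 3^-1) z) = 0.
  by apply: (@addrI _ (c ^+ 3 * cexp (W z) + d ^+ 3 * cexp (- W z))); rewrite -key H addr0.
apply/eqP/negPn/negP => n0.
have {}H z : c * lexp W 3^-1 z + d * lexp W (- 3^-1) z = 0.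
  by apply/eqP; have /eqP := H z; rewrite mulf_eq0 (negPf n0).
have W3 (w : R[i]) : lexp W 3^-1 ((3 * w) *: v1) = cexp w.
  by rewrite /lexp (linear_form_onto Wv1) mulKf// pnatr_eq0.
have W3N (w : R[i]) : lexp W (- 3^-1) ((3 * w) *: v1) = cexp (- w).
  by rewrite /lexp (linear_form_onto Wv1) mulNr mulKf// pnatr_eq0.
move: c0; apply/negP; rewrite negbK; apply/eqP; apply: (exp_combination_eq0 (d := d)).
  by have := H ((3 * 0) *: v1); rewrite W3 W3N oppr0 cexp0 !mulr1.
by have := H ((3 * (0 +i* (pi / 2))) *: v1); rewrite W3 W3N.
Qed.

(** Restriction to a line reduces transcendence to one variable. *)
Lemma meval_line (K : comNzRingType) (m : nat) (p : mpoly.mpoly m K) (v : 'rV[K]_m) :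
  exists q : {poly K}, forall s, q.[s] = mpoly.meval (fun k => (s *: v) 0 k) p.
Proof.
exists (\sum_(a <- mpoly.msupp p) (mpoly.mcoeff a p)%:P *
   \prod_i (v 0 i *: 'X) ^+ mpoly.fun_of_multinom a i) => s.
rewrite mpoly.mevalE horner_sum; apply: eq_bigr => a _.
rewrite hornerM hornerC horner_prod; congr (_ * _); apply: eq_bigr => i _.
by rewrite horner_exp hornerZ hornerX mxE mulrC.
Qed.

Lemma cexp_2pi (R : realType) : cexp (0 +i* (pi *+ 2)) = 1 :> R[i].
Proof. by rewrite /cexp /= expR0 cos2pi sin2pi mulr0 mulr1. Qed.

(** Such a q takes the value c + d at all points 6 pi i k, so it is constant. Evaluating the
    exponential sum at s / 3 = i pi gives c + d = -(c + d) = 0, and at i pi/2 it then gives c =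
    0. *)
Lemma exponential_not_polynomial (R : realType) (q : {poly R[i]}) (c d : R[i]) :
  c != 0 -> ~ forall s, q.[s] = c * cexp (s / 3) + d * cexp (- s / 3).
Proof.
move=> c0 qE.
pose P : R[i] := 0 +i* (pi *+ 2).
have P0 : P != 0 by rewrite eq_complex /= eqxx mulrn_eq0/= gt_eqF ?pi_gt0.
have three : (3 : R[i]) != 0 by rewrite pnatr_eq0.
have qP k : q.[P *+ k * 3] = c + d.
  rewrite qE mulNr mulfK// cexpN cexp_mulrn cexp_2pi expr1n invr1.
  by rewrite !mulr1.
have qC : q = (c + d)%:P.
  apply/eqP; rewrite -subr_eq0; apply/negPn/negP => r0.
  (* As many distinct roots as the size, that is, one more than the degree. *)
  pose rs := [seq P *+ k * 3 | k <- iota 0 (size (q - (c + d)%:P))].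
  have := @max_poly_roots _ _ rs r0; rewrite size_map size_iota ltnn => H.
  suff : false by []; apply: H.
    apply/allP => _ /mapP[k _ ->].
    by rewrite /root hornerD hornerN hornerC qP subrr.
  rewrite map_inj_uniq ?iota_uniq// => i j /(mulIf three).
  exact: mulrIn.
have cst s : c * cexp s + d * cexp (- s) = c + d.
  by have := qE (s * 3); rewrite qC hornerC mulNr mulfK// => <-.
have cpi : cexp (0 +i* pi) = -1 :> R[i].
  by rewrite /cexp /= expR0 cospi sinpi mulr0 mul1r; simpc.
have cd0 : c + d = 0.
  have := cst (0 +i* pi); rewrite cexpN cpi invrN1 -mulrDl mulrN1 => /eqP.
  by rewrite eq_sym -addr_eq0 -mulr2n mulrn_eq0 /= => /eqP.
have := cst (0 +i* (pi / 2)); rewrite cd0 => /(exp_combination_eq0 cd0) /eqP.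
by rewrite (negPf c0).
Qed.

(** * The pairing as a linear form, and the conclusion *)

Section final.
Variables (R : realType) (m : nat) (lam : 'rV[R[i]]_m).

Lemma pairing_is_linear : linear (pairing lam : 'rV[R[i]]_m -> R[i]^o).
Proof.
move=> a x y; rewrite /pairing /GRing.scale /= mulr_sumr -big_split /=.
by apply: eq_bigr => k _; rewrite !mxE; ring.
Qed.

HB.instance Definition _ := GRing.isLinear.Build R[i] 'rV[R[i]]_m R[i]^o _
  (pairing lam : 'rV[R[i]]_m -> R[i]^o) pairing_is_linear.

Lemma entire_pairing : entire (pairing lam).
Proof.
move=> z.
have -> : (pairing lam : 'rV[R[i]]_m -> R[i]^o) =
    \sum_(k < m) (fun z : 'rV[R[i]]_m => lam 0 k * z 0 k : R[i]^o).
  by apply/funext => w; rewrite fct_sumE.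
apply: differentiable_sum => k.
exact: (differentiableZ (lam 0 k) (differentiable_coord z 0 k)).
Qed.
End final.

Theorem theorem2p4 (R : realType) (m : nat) (u lam : 'rV[R[i]]_m)
    (p1 p2 : R[i]) (l : nat)
    (m_ge1 : (1 <= m)%N) (u_neq0 : u != 0) (p1_neq0 : p1 != 0)
    (p2_neq0 : p2 != 0) (lam_neq0 : forall k : 'I_m, lam 0 k != 0)
    (l_ge2 : (2 <= l)%N) (l_even : ~~ odd l) :
  ((exists f : 'rV[R[i]]_m -> R[i]^o,
      transcendental_entire f /\ pde_solution u lam p1 p2 l f) <->
   (exists c d : R[i], admissible u lam p1 p2 l c d)) /\
  (forall f : 'rV[R[i]]_m -> R[i]^o,
     (transcendental_entire f /\ pde_solution u lam p1 p2 l f) <->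
     (exists c d : R[i], admissible u lam p1 p2 l c d /\
        forall z, f z = c * cexp (pairing lam z / 3)
                        + d * cexp (- pairing lam z / 3))).
Proof.
(* The solvability criterion follows from the description of the solutions: an admissible pair (c,
   d) defines its own witness f. *)
suff H (f : 'rV[R[i]]_m -> R[i]^o) :
    (transcendental_entire f /\ pde_solution u lam p1 p2 l f) <->
     (exists c d : R[i], admissible u lam p1 p2 l c d /\
        forall z, f z = c * cexp (pairing lam z / 3)
                        + d * cexp (- pairing lam z / 3)).
  split => //; split=> [[f /H[c [d [cd _]]]]|[c [d cd]]]; first by exists c, d.
  by exists (fun z => c * cexp (pairing lam z / 3) + d * cexp (- pairing lam z / 3));
    apply/H; exists c, d.
have [a a0 lE] : exists2 a, (0 < a)%N & l = (2 * a)%N.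
  exists l./2; first by rewrite half_gt0.
  by rewrite mul2n -[LHS]odd_double_half (negPf l_even).
pose k0 : 'I_m := Ordinal m_ge1.
pose V : normedModType R[i] := 'rV[R[i]]_m.
pose W : {linear V -> R[i]^o} := (pairing lam : V -> R[i]^o).
have cW : continuous W.
  by move=> z; exact: differentiable_continuous (entire_pairing lam z).
pose v1 : V := (lam 0 k0)^-1 *: delta_mx 0 k0.
have Wv1 : W v1 = 1.
  rewrite -[LHS]/(pairing lam v1) /pairing (bigD1 k0)//= big1 => [|k kk0].
    by rewrite !mxE !eqxx mulr1 addr0 mulfV.
  by rewrite !mxE eqxx (negPf kk0) !mulr0.
have Wu : (\sum_(k < m) u 0 k * lam 0 k / 3) = W u / 3.
  rewrite -mulr_suml; congr (_ / _).
  by apply: eq_bigr => k _; rewrite mulrC.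
have formE c d : (fun z => c * cexp (pairing lam z / 3) + d * cexp (- pairing lam z / 3)) =
    (fun z => c * lexp W 3^-1 z + d * lexp W (- 3^-1) z).
  by apply/funext => z; rewrite /lexp !mulNr [3^-1 * W z]mulrC.
(* The two operators agree only on entire functions, so each iterate must be known to be entire
   before the next step. *)
have iterE g : entire g -> iter l (dpartial u) g = iter (2 * a) (dird u) g.
  move=> dg; rewrite -lE; elim: (l) => // n IH.
  by rewrite !iterS IH (dpartialE u (differentiable_iter_dird u n dg)).
split.
  move=> [[df _] eqf].
  have eqf' z : f z ^+ 3 + iter (2 * a) (dird u) f z =
      p1 * cexp (W z) + p2 * cexp (- W z) by rewrite -(iterE f df); exact: eqf.
  have [c [d [c3 d3 fE]]] := classification cW Wv1 p1_neq0 p2_neq0 a0 df eqf'.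
  have c0 : c != 0 by apply: contraNneq p1_neq0 => c0; rewrite -c3 c0 expr0n.
  have d0 : d != 0 by apply: contraNneq p2_neq0 => d0; rewrite -d3 d0 expr0n.
  have fF : f = (fun z => c * lexp W 3^-1 z + d * lexp W (- 3^-1) z) by exact/funext.
  exists c, d; split; last by move=> z; rewrite fE -(congr1 (@^~ z) (formE c d)).
  split => //; rewrite Wu lE; apply/(pde_lexp2P u d a cW Wv1 c0) => z.
  by rewrite -fF -fE eqf' c3 d3.
move=> [c [d [[c0 d0 c3 d3 cd] /funext ->]]].
have dF : entire (fun z => c * cexp (pairing lam z / 3) + d * cexp (- pairing lam z / 3)).
  by rewrite formE => z; exact: differentiable_lexp2.
split; last first.
  move=> z; rewrite (iterE _ dF) formE -c3 -d3.
  have cd' : 3 * c * d + (W u / 3) ^+ (2 * a) = 0 by rewrite -lE -Wu.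
  have P := (pde_lexp2P u d a cW Wv1 c0).2 cd' z.
  by rewrite -P [X in X ^+ 3 + _ = _](congr1 (@^~ z) (formE c d)).
split => // -[p pE].
have [q qE] := meval_line p v1.
apply: (exponential_not_polynomial (q := q) (d := d) c0) => s.
rewrite qE -pE (_ : pairing lam (s *: v1) = s)//.
exact: (linear_form_onto Wv1).
Qed.
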